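(* Let $P_0=N(0,I_d)$ be the standard Gaussian on $\mathbb{R}^d$ and let $k(x,y)=\exp(-\gamma\|x-y\|_2^2)$ with $\gamma>0$. The plug-in scale $\sqrt{\operatorname{tr}(C_\star)/n}$ equals $\sqrt{(1+2\gamma)d/n}$. Moreover: (1) (Fixed bandwidth.) For fixed $\gamma>0$, $\operatorname{tr}(C_\star^2)\asymp_\gamma d^2(1+8\gamma)^{-d/2}$, the optimal scale satisfies \[ \frac{\operatorname{tr}(C_\star^2)^{1/4}}{\sqrt n}\asymp_\gamma\frac{d^{1/2}(1+8\gamma)^{-d/8}}{\sqrt n}, \] and the gap satisfies $r_{\mathrm{eff}}(C_\star)^{1/4}\asymp_\gamma(1+8\gamma)^{d/8}$, so it is exponential in $d$. (2) (Scaled bandwidth.) If $\gamma=\alpha/d$ for fixed $\alpha>0$, then $\operatorname{tr}(C_\star^2)\asymp_\alpha d$, the optimal scale satisfies \[ \frac{\operatorname{tr}(C_\star^2)^{1/4}}{\sqrt n}\asymp_\alpha\frac{d^{1/4}}{\sqrt n}, \] and the gap satisfies $r_{\mathrm{eff}}(C_\star)^{1/4}\asymp_\alpha d^{1/4}$, so it is polynomial in $d$.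
   Context: For a distribution $P_0$ on $\mathbb{R}^d$ with continuously differentiable, everywhere positive density $p_0$, the score is $s_0(x)=\nabla\log p_0(x)$. For a kernel $k$ with reproducing kernel Hilbert space $\mathcal{H}_k$, the Langevin--Stein feature map is $\xi_{P_0}(x):=s_0(x)k(x,\cdot)+\nabla_xk(x,\cdot)\in\mathcal{H}:=\mathcal{H}_k^d$. The Stein covariance operator is $C_\star:=\mathbb{E}_{P_0}[\xi_{P_0}(X)\otimes\xi_{P_0}(X)]$ on $\mathcal{H}$, where $a\otimes b$ is the operator $x\mapsto\langle b,x\rangle a$. For sample size $n$, the plug-in scale is $\sqrt{\operatorname{tr}(C_\star)/n}$, the optimal scale is $\operatorname{tr}(C_\star^2)^{1/4}/\sqrt n$, and the gap is $r_{\mathrm{eff}}(C_\star)^{1/4}$, where $r_{\mathrm{eff}}(C_\star):=\operatorname{tr}(C_\star)^2/\operatorname{tr}(C_\star^2)$. Notation: $a\asymp_\gamma b$ (resp. $\asymp_\alpha$) means $C^{-1}b\le a\le Cb$ for a constant $C>0$ depending only on $\gamma$ (resp. $\alpha$), uniformly in the dimension $d$ and in $n$. *)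

(* Defs.v *)
(* The library puts the product sigma-algebra on d-tuples
   and the normed-space structure on row vectors: measures live on
   [d.-tuple (measurableTypeR R)], calculus is done on ['rV[R]_d], and [vec]
   maps the former to the latter.  The norm [`|x|] of ['rV[R]_d] is the
   sup-norm, hence the separate [sqnorm]. *)
From HB Require Import structures.
From mathcomp Require Import all_boot all_order all_algebra.
From mathcomp Require Import all_classical all_reals all_analysis.
From mathcomp Require Import measurable_realfun.

Set Implicit Arguments.
Unset Strict Implicit.
Unset Printing Implicit Defensive.
Import Order.TTheory GRing.Theory Num.Theory.
Import numFieldNormedType.Exports.

Local Open Scope classical_set_scope.
Local Open Scope ring_scope.

Section product_power.
Context {dT} {T : measurableType dT} {R : realType}.

Definition tcons d (p : T * d.-tuple T) : d.+1.-tuple T :=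
  [tuple of p.1 :: p.2].

Definition tuncons d (x : d.+1.-tuple T) : T * d.-tuple T :=
  (thead x, [tuple of behead x]).

Lemma tconsK d : cancel (@tcons d) (@tuncons d).
Proof. by case=> a x; congr (_, _); apply: val_inj. Qed.

Lemma measurable_tcons d : measurable_fun [set: _] (@tcons d).
Proof. exact: measurable_cons. Qed.

Lemma measurable_tuncons d : measurable_fun [set: _] (@tuncons d).
Proof.
apply/measurable_fun_pairP; split; last exact: measurable_behead.
exact: (@measurable_tnth _ T d.+1 ord0).
Qed.

Definition cons_measure d (m : {sigma_finite_measure set T -> \bar R})
    (mu : {sigma_finite_measure set (d.-tuple T) -> \bar R}) :
    set (d.+1.-tuple T) -> \bar R :=
  pushforward (m \x mu)%E (@tcons d).

Section cons_measure.
Variables (m : {sigma_finite_measure set T -> \bar R}) (d : nat).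
Variable mu : {sigma_finite_measure set (d.-tuple T) -> \bar R}.

Let cons_measure0 : cons_measure m mu set0 = 0%E.
Proof. by rewrite /cons_measure /pushforward preimage_set0 measure0. Qed.

Let cons_measure_ge0 A : (0 <= cons_measure m mu A)%E.
Proof. by rewrite /cons_measure /pushforward measure_ge0. Qed.

Let cons_measure_sigma_additive : semi_sigma_additive (cons_measure m mu).
Proof.
move=> F mF tF mUF; rewrite /cons_measure /pushforward preimage_bigcup.
have mt A : measurable A -> measurable (@tcons d @^-1` A).
  by move=> mA; rewrite -[X in measurable X]setTI; exact: measurable_tcons.
apply: measure_semi_sigma_additive.
- by move=> n; exact: mt.
- apply/trivIsetP => /= i j _ _ ij; rewrite -preimage_setI.
  by move/trivIsetP : tF => /(_ _ _ _ _ ij) ->//; rewrite preimage_set0.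
- by rewrite -preimage_bigcup; exact: mt.
Qed.

HB.instance Definition _ := isMeasure.Build _ _ _ (cons_measure m mu)
  cons_measure0 cons_measure_ge0 cons_measure_sigma_additive.

Let cons_measure_sigma_finite : sigma_finite setT (cons_measure m mu).
Proof.
have /sigma_finiteP[F [TF ndF Foo]] := sigma_finiteT m.
have /sigma_finiteP[G [TG ndG Goo]] := sigma_finiteT mu.
exists (fun n => @tuncons d @^-1` (F n `*` G n)).
  apply/seteqP; split => // x _.
  have [k _ Fk] : (\bigcup_k F k) (tuncons x).1 by rewrite -TF.
  have [l _ Gl] : (\bigcup_k G k) (tuncons x).2 by rewrite -TG.
  exists (maxn k l) => //; split.
  - by move: Fk; exact/subsetPset/ndF/leq_maxl.
  - by move: Gl; exact/subsetPset/ndG/leq_maxr.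
move=> n; have [mF Fn] := Foo n; have [mG Gn] := Goo n; split.
  rewrite -[X in measurable X]setTI; apply: measurable_tuncons => //.
  exact: measurableX.
rewrite /cons_measure /pushforward (_ : _ @^-1` _ = F n `*` G n); last first.
  by apply/funext => x; congr ((F n `*` G n) _); exact: tconsK.
by rewrite product_measure1E// lte_mul_pinfty// ge0_fin_numE.
Qed.

HB.instance Definition _ := Measure_isSigmaFinite.Build _ _ _
  (cons_measure m mu) cons_measure_sigma_finite.

End cons_measure.

Fixpoint power_measure (m : {sigma_finite_measure set T -> \bar R}) d :
    {sigma_finite_measure set (d.-tuple T) -> \bar R} :=
  match d with
  | 0 => dirac ([tuple] : 0.-tuple T)
  | d'.+1 => cons_measure m (power_measure m d')
  end.

End product_power.

Notation Rtuple R d := (d.-tuple (measurableTypeR R)).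

Section gaussian.
Context {R : realType}.

Definition vec d (t : Rtuple R d) : 'rV[R]_d := \row_i tnth t i.

Definition sqnorm d (x : 'rV[R]_d) : R := \sum_(i < d) x 0 i ^+ 2.

Definition lebesgue_tuple d : {sigma_finite_measure set (Rtuple R d) -> \bar R} :=
  power_measure (@lebesgue_measure R) d.

Definition gaussian_density d (x : 'rV[R]_d) : R :=
  (2 * pi) `^ (- (d%:R / 2)) * expR (- sqnorm x / 2).

Lemma gaussian_density_ge0 d (x : 'rV[R]_d) : 0 <= gaussian_density x.
Proof. by rewrite mulr_ge0// ?powR_ge0// expR_ge0. Qed.

Lemma gaussian_density_prod d (t : Rtuple R d) :
  gaussian_density (vec t) = \prod_(i < d) normal_pdf 0 1 (tnth t i).
Proof.
have pi2 : 0 < 2 * pi :> R by rewrite mulr_gt0// pi_gt0.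
under eq_bigr do rewrite normal_pdfE ?oner_neq0//.
rewrite big_split/= prodr_const card_ord /normal_peak /normal_fun -expR_sum.
congr (_ * expR _).
  rewrite expr1n mul1r -[pi *+ 2]mulr_natl -powR12_sqrt ?ltW//.
  by rewrite -powRN -powR_mulrn ?powR_ge0// -powRrM mulNr [2^-1 * _]mulrC.
rewrite /sqnorm -sumrN mulr_suml; apply: eq_bigr => i _.
by rewrite mxE subr0 expr1n.
Qed.

Lemma measurable_gaussian_density d :
  measurable_fun [set: _] (fun t : Rtuple R d => gaussian_density (vec t)).
Proof.
under eq_fun do rewrite gaussian_density_prod.
apply: measurable_prod => i _.
apply: measurableT_comp; first exact: measurable_normal_pdf.
exact: (@measurable_tnth _ (measurableTypeR R)).
Qed.

Lemma integral_gaussian_density d :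
  (\int[lebesgue_tuple d]_t (gaussian_density (vec t))%:E = 1)%E.
Proof.
have mg n : measurable_fun [set: _]
    (fun t : Rtuple R n => (gaussian_density (vec t))%:E).
  by apply: measurableT_comp => //; exact: measurable_gaussian_density.
have g0 n (t : Rtuple R n) : (0 <= (gaussian_density (vec t))%:E)%E.
  by rewrite lee_fin gaussian_density_ge0.
elim: d => [|d IH].
  rewrite [LHS](integral_dirac _ measurableT (mg 0%N)) diracT mul1e.
  by rewrite gaussian_density_prod big_ord0.
pose mu := power_measure (@lebesgue_measure R) d.
rewrite [LHS](ge0_integral_pushforward (@measurable_tcons _ _ d)
  (product_measure1 (@lebesgue_measure R) mu) measurableT (mg d.+1))//.
rewrite preimage_setT (fubini_tonelli1 (m2 := mu))//=; last first.
  exact: (measurableT_comp (mg d.+1) (@measurable_tcons _ _ d)).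
rewrite -[RHS](integral_normal_pdf 0 1); apply: eq_integral => x _.
rewrite /fubini_F/= -[RHS]mule1 -IH -ge0_integralZl//; last 2 first.
- exact: mg.
- by rewrite lee_fin normal_pdf_ge0.
apply: eq_integral => y _; rewrite -EFinM !gaussian_density_prod big_ord_recl.
by congr (_ * _)%:E; apply: eq_bigr => i _; rewrite tnthS.
Qed.

Definition gaussian_measure d : set (Rtuple R d) -> \bar R :=
  fun A => (\int[lebesgue_tuple d]_(t in A) (gaussian_density (vec t))%:E)%E.

Section gaussian_measure.
Variable d : nat.

Let gaussian_measure0 : gaussian_measure (set0 : set (Rtuple R d)) = 0%E.
Proof. by rewrite /gaussian_measure integral_set0. Qed.

Let gaussian_measure_ge0 (A : set (Rtuple R d)) : (0 <= gaussian_measure A)%E.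
Proof.
by apply: integral_ge0 => t _; rewrite lee_fin gaussian_density_ge0.
Qed.

Let gaussian_measure_sigma_additive :
  semi_sigma_additive (@gaussian_measure d).
Proof.
apply: semi_sigma_additive_nng_induced => [|t].
  by apply: measurableT_comp => //; exact: measurable_gaussian_density.
by rewrite lee_fin gaussian_density_ge0.
Qed.

HB.instance Definition _ := isMeasure.Build _ _ _ (@gaussian_measure d)
  gaussian_measure0 gaussian_measure_ge0 gaussian_measure_sigma_additive.

Let gaussian_measureT : gaussian_measure [set: Rtuple R d] = 1%E.
Proof. exact: integral_gaussian_density. Qed.

HB.instance Definition _ := Measure_isProbability.Build _ _ _
  (@gaussian_measure d) gaussian_measureT.

End gaussian_measure.

Definition std_gaussian d : probability (Rtuple R d) R := @gaussian_measure d.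

End gaussian.

Section hilbert.
Context {R : realType}.

(* A candidate Hilbert space carried by a subset of a vector space [V] (below,
   a space of functions); [hdot] is meaningful on [hset] only. *)
Record hspace (V : lmodType R) := HSpace {
  hset : set V;
  hdot : V -> V -> R }.

Variable V : lmodType R.
Implicit Types (H : hspace V) (u v w : V).

Definition hnorm H u : R := Num.sqrt (hdot H u u).

Record is_hilbert H : Prop := {
  hset0 : hset H 0;
  hset_lin : forall a u v, hset H u -> hset H v -> hset H (a *: u + v);
  hdot_sym : forall u v, hset H u -> hset H v -> hdot H u v = hdot H v u;
  hdot_lin : forall a u v w, hset H u -> hset H v -> hset H w ->
    hdot H (a *: u + v) w = a * hdot H u w + hdot H v w;
  hdot_gt0 : forall u, hset H u -> u <> 0 -> 0 < hdot H u u;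
  hcomplete : forall s : nat -> V, (forall n, hset H (s n)) ->
    (forall e, 0 < e -> exists N, forall m n, (N <= m)%N -> (N <= n)%N ->
      hnorm H (s m - s n) < e) ->
    exists2 u, hset H u & hnorm H (s n - u) @[n --> \oo] --> (0 : R) }.

Definition orthonormal_basis H (E : set V) : Prop :=
  [/\ E `<=` hset H,
      forall e, E e -> hdot H e e = 1,
      forall e f, E e -> E f -> e <> f -> hdot H e f = 0
    & forall u, hset H u -> (forall e, E e -> hdot H u e = 0) -> u = 0].

(* Trace of a positive operator, computed in the orthonormal basis [E]; [esum]
   is the supremum of the finite subsums, and [fine] sends an infinite trace
   to 0. *)
Definition trace H (E : set V) (T : V -> V) : R :=
  fine (\esum_(e in E) (hdot H e (T e))%:E).

Definition plugin_scale H E (T : V -> V) (n : nat) : R :=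
  Num.sqrt (trace H E T / n%:R).

Definition optimal_scale H E (T : V -> V) (n : nat) : R :=
  trace H E (T \o T) `^ (1 / 4) / Num.sqrt n%:R.

Definition effective_rank H E (T : V -> V) : R :=
  trace H E T ^+ 2 / trace H E (T \o T).

Definition scale_gap H E (T : V -> V) : R := effective_rank H E T `^ (1 / 4).

Definition tensor H (a b : V) : V -> V := fun x => hdot H b x *: a.

End hilbert.

Section rkhs.
Context {R : realType} {X : Type}.

Definition is_rkhs (k : X -> X -> R) (H : hspace (X -> R^o)) : Prop :=
  [/\ is_hilbert H,
      forall x, hset H (k x)
    & forall f x, hset H f -> hdot H f (k x) = f x].

(* H^d, realised as a space of vector-valued functions. *)
Definition hpow (H : hspace (X -> R^o)) d : hspace (X -> 'rV[R]_d) :=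
  HSpace [set F : X -> 'rV[R]_d | forall i, hset H (fun x => F x 0 i)]
         (fun F G : X -> 'rV[R]_d => \sum_(i < d) hdot H (fun x => F x 0 i) (fun x => G x 0 i)).

End rkhs.

Section stein.
Context {R : realType}.

Definition grad d (f : 'rV[R]_d -> R) (x : 'rV[R]_d) : 'rV[R]_d :=
  \row_i 'D_('e_i) f x.

Definition score d (p : 'rV[R]_d -> R) (x : 'rV[R]_d) : 'rV[R]_d :=
  grad (fun z => ln (p z)) x.

Definition stein_feature d (p : 'rV[R]_d -> R)
    (k : 'rV[R]_d -> 'rV[R]_d -> R) (x : 'rV[R]_d) : 'rV[R]_d -> 'rV[R]_d :=
  fun y => k x y *: score p x + grad (fun z => k z y) x.

(* The expectation of the rank-one operators is taken entrywise: evaluation of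
   a component at a point [y] is a continuous linear functional on H^d, so it
   commutes with the (Bochner) expectation of [tensor (xi X) (xi X) F]. *)
Definition stein_cov d (P : probability (Rtuple R d) R) (p : 'rV[R]_d -> R)
    (k : 'rV[R]_d -> 'rV[R]_d -> R) (H : hspace ('rV[R]_d -> R^o))
    (F : 'rV[R]_d -> 'rV[R]_d) : 'rV[R]_d -> 'rV[R]_d :=
  let xi t := stein_feature p k (vec t) in
  fun y => \row_i \int[P]_t (tensor (hpow H d) (xi t) (xi t) F y 0 i).

Definition gauss_kernel d (gamma : R) (x y : 'rV[R]_d) : R :=
  expR (- gamma * sqnorm (x - y)).

Definition gauss_stein_cov d (gamma : R) (H : hspace ('rV[R]_d -> R^o)) :
    ('rV[R]_d -> 'rV[R]_d) -> 'rV[R]_d -> 'rV[R]_d :=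
  stein_cov (std_gaussian d) (@gaussian_density R d) (gauss_kernel gamma) H.

Definition within_factor (C a b : R) : Prop := C^-1 * b <= a /\ a <= C * b.

End stein.

(* Main.v *)
Require Import Defs.
From HB Require Import structures.
From mathcomp Require Import all_boot all_order all_algebra.
From mathcomp Require Import all_classical all_reals all_analysis.
From mathcomp Require Import measurable_realfun ring lra.

Set Implicit Arguments.
Unset Strict Implicit.
Unset Printing Implicit Defensive.
Import Order.TTheory GRing.Theory Num.Theory.
Import numFieldNormedType.Exports.

Local Open Scope classical_set_scope.
Local Open Scope ring_scope.

(* The kernel of the Stein feature map is
     <xi x, xi y> = exp (- gamma |x - y|^2) *
                    (x.y - (2 gamma + 4 gamma^2) |x - y|^2 + 2 gamma d).
   Parseval turns the traces into integrals,
     tr C = E <xi X, xi X>   and   tr C^2 = E <xi X, xi Y>^2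
   for independent standard Gaussian X and Y. Both integrands are sums of
   products over the coordinates, so that Gaussian moments of order at most 4
   give the closed forms tr C = (1 + 2 gamma) d and
     tr C^2 = (1 + 8 gamma)^(- d / 2) * (m^2 d^2 + v d),
   with m = 2 gamma (1 + 4 gamma) / (1 + 8 gamma) and
   v = (1 + ((1 + 4 gamma)^2 / (1 + 8 gamma))^2) / 2. For fixed gamma the
   d^2 term dominates; for gamma = alpha / d the quantity m d and the prefactor
   stay bounded and the v d term dominates. *)

(** * Hilbert spaces *)

(** [H] is an arbitrary reproducing kernel Hilbert space of the kernel and [E] an arbitrary
    orthonormal basis, so nothing can be read off a concrete model. Three facts have to come from
    the reproducing property itself: the partial derivatives of the kernel lie in [H] (as limits of
    difference quotients), the entrywise integral that defines the covariance lands in H^d (it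
    equals a Riesz representer), and [E] is countable, which the exchange of sum and integral
    requires (kernel sections at grid points are total). The closed form of tr C^2 is the second
    moment of a sum. The factor exp (- 2 gamma |x - y|^2) has mean (1 + 8 gamma)^(- d / 2), and
    tilting the law of (X, Y) by it keeps the d coordinate pairs independent and identically
    distributed. The numbers m and v are the mean and the variance of one summand under the tilted
    law, whence m^2 d^2 + v d. *)

Lemma cvg_sumr {R : realType} {T : Type} {F : set_system T} {FF : Filter F}
    {I : Type} (r : seq I) (f : I -> T -> R) (l : I -> R) :
  (forall i, f i x @[x --> F] --> l i) ->
  \sum_(i <- r) f i x @[x --> F] --> \sum_(i <- r) l i.
Proof.
by move=> fl; apply: cvg_big => [|i _]; [exact: add_continuous|exact: fl].
Qed.

Section hilbert_theory.
Context {R : realType} {V : lmodType R}.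
Variable H : hspace V.
Hypothesis hH : is_hilbert H.
Local Notation S := (hset H).
Local Notation dot := (hdot H).
Implicit Types u v w : V.

Lemma hsetZ a u : S u -> S (a *: u).
Proof. by move=> Su; rewrite -[_ *: _]addr0; apply: hset_lin => //; exact: hset0. Qed.

Lemma hsetD u v : S u -> S v -> S (u + v).
Proof. by move=> Su Sv; rewrite -[u]scale1r; exact: hset_lin. Qed.

Lemma hsetB u v : S u -> S v -> S (u - v).
Proof. by move=> Su Sv; rewrite addrC -scaleN1r; exact: hset_lin. Qed.

Lemma hset_sum (I : Type) (r : seq I) (P : pred I) (F : I -> V) :
  (forall i, P i -> S (F i)) -> S (\sum_(i <- r | P i) F i).
Proof.
by move=> SF; elim/big_ind : _ => //; [exact: hset0|exact: hsetD].
Qed.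

Lemma hdotDl u v w : S u -> S v -> S w -> dot (u + v) w = dot u w + dot v w.
Proof.
by move=> *; rewrite -[u in LHS]scale1r (hdot_lin hH)// mul1r.
Qed.

Lemma hdot0l w : S w -> dot 0 w = 0.
Proof.
move=> Sw; have S0 := hset0 hH.
by have := hdotDl S0 S0 Sw; rewrite addr0 => /eqP; rewrite -subr_eq subrr => /eqP.
Qed.

Lemma hdotZl a u w : S u -> S w -> dot (a *: u) w = a * dot u w.
Proof.
move=> Su Sw; rewrite -[_ *: u]addr0 (hdot_lin hH) ?hdot0l ?addr0//.
exact: hset0.
Qed.

Lemma hdotBl u v w : S u -> S v -> S w -> dot (u - v) w = dot u w - dot v w.
Proof.
move=> Su Sv Sw; rewrite -scaleN1r hdotDl ?hdotZl ?mulN1r//.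
exact: hsetZ.
Qed.

Lemma hdot_suml (I : Type) (r : seq I) (F : I -> V) w :
  (forall i, S (F i)) -> S w ->
  dot (\sum_(i <- r) F i) w = \sum_(i <- r) dot (F i) w.
Proof.
move=> SF Sw; elim: r => [|i r IH]; first by rewrite !big_nil hdot0l.
by rewrite !big_cons hdotDl ?IH//; exact: hset_sum.
Qed.

Lemma hdotDr u v w : S u -> S v -> S w -> dot w (u + v) = dot w u + dot w v.
Proof.
move=> Su Sv Sw; rewrite !(hdot_sym hH Sw)// ?hdotDl//; exact: hsetD.
Qed.

Lemma hdotZr a u w : S u -> S w -> dot w (a *: u) = a * dot w u.
Proof.
move=> Su Sw; rewrite !(hdot_sym hH Sw)// ?hdotZl//; exact: hsetZ.
Qed.

Lemma hdotBr u v w : S u -> S v -> S w -> dot w (u - v) = dot w u - dot w v.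
Proof.
move=> Su Sv Sw; rewrite !(hdot_sym hH Sw)// ?hdotBl//; exact: hsetB.
Qed.

Lemma hdot_ge0 u : S u -> 0 <= dot u u.
Proof.
move=> Su; have [->|/eqP u0] := eqVneq u 0; last exact/ltW/hdot_gt0.
by rewrite hdot0l//; exact: hset0.
Qed.

Lemma hdot_eq0 u : S u -> dot u u = 0 -> u = 0.
Proof.
move=> Su uu; apply: contrapT => u0.
by have := hdot_gt0 hH Su u0; rewrite uu ltxx.
Qed.

Lemma hdot_sqB u v : S u -> S v ->
  dot (u - v) (u - v) = dot u u - 2 * dot u v + dot v v.
Proof.
move=> Su Sv; have Suv := hsetB Su Sv.
rewrite hdotBl// !hdotBr// (hdot_sym hH Sv Su); ring.
Qed.

Lemma cauchy_schwarz u v : S u -> S v -> dot u v ^+ 2 <= dot u u * dot v v.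
Proof.
move=> Su Sv; have [->|/eqP v0] := eqVneq v 0.
  have S0 := hset0 hH.
  by rewrite (hdot_sym hH Su S0) !hdot0l// expr0n mulr0.
have vv := hdot_gt0 hH Sv v0.
have := hdot_ge0 (hsetB (hsetZ (dot v v) Su) (hsetZ (dot u v) Sv)).
rewrite hdot_sqB ?hdotZl ?hdotZr//; [|exact: hsetZ..] => h.
have : 0 <= dot v v * (dot u u * dot v v - dot u v ^+ 2) by move: h; lra.
by rewrite pmulr_rge0// subr_ge0.
Qed.

(** Completeness in the form used below: the Cauchy condition is on squared norms and the limit is
    known through its pairings, so square roots stay inside this proof. *)
Lemma hcomplete_weak (s : nat -> V) : (forall n, S (s n)) ->
  (forall e : R, 0 < e -> exists N, forall m n, (N <= m)%N -> (N <= n)%N ->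
    dot (s m - s n) (s m - s n) < e) ->
  exists2 u, S u & forall v, S v -> dot (s n) v @[n --> \oo] --> dot u v.
Proof.
move=> Ss sC.
have [|u Su su] := hcomplete hH Ss.
  move=> e e0; have [|N hN] := sC (e ^+ 2); first exact: exprn_gt0.
  exists N => m n Nm Nn; rewrite /hnorm -(ger0_norm (ltW e0)) -sqrtr_sqr.
  by rewrite ltr_sqrt ?exprn_gt0// hN.
exists u => // v Sv; apply/subr_cvg0.
apply: norm_cvg0; apply: (@squeeze_cvgr _ _ _ _ (fun=> 0)
    (fun n => hnorm H (s n - u) * hnorm H v)); last 2 first.
- exact: cvg_cst.
- by rewrite -[0](mul0r (hnorm H v)); apply: cvgMl.
near=> n; rewrite normr_ge0/= -hdotBl// -sqrtr_sqr /hnorm -sqrtrM ?hdot_ge0//.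
- by rewrite ler_wsqrtr// cauchy_schwarz//; exact: hsetB.
- exact: hsetB.
Unshelve. all: by end_near. Qed.

(* The representer minimises [dot u u - 2 * phi u]. *)
Lemma riesz (phi : V -> R) (M : R) :
  (forall a u v, S u -> S v -> phi (a *: u + v) = a * phi u + phi v) ->
  (forall u, S u -> phi u ^+ 2 <= M * dot u u) ->
  exists2 w, S w & forall u, S u -> dot w u = phi u.
Proof.
move=> phil phiM; have S0 := hset0 hH.
pose J u := dot u u - 2 * phi u.
(* From [phi u ^+ 2 <= M * dot u u] and the inequality of arithmetic and geometric means,
   [2 * phi u <= dot u u + |M|]. *)
have Jge u : S u -> - `|M| <= J u.
  move=> Su; have := phiM _ Su; have := hdot_ge0 Su; have := ler_norm M.
  have := normr_ge0 M; rewrite /J.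
  move: (phi u) (dot u u) `|M| => p x m m0 Mm x0 pM.
  have [p0|p0] := leP p 0; first by lra.
  have pm : p ^+ 2 <= m * x by apply: (le_trans pM); exact: ler_wpM2r.
  suff : 2 * p <= x + m by lra.
  rewrite -(@ler_pXn2r _ 2)// ?nnegrE ?mulr_ge0 ?addr_ge0//; last exact: ltW.
  have := sqr_ge0 (x - m); nra.
have JS : has_inf [set J u | u in S].
  by split; [exists (J 0); exists 0|exists (- `|M|) => _ [u Su <-]; exact: Jge].
set m := inf [set J u | u in S].
have mJ u : S u -> m <= J u by move=> Su; apply: ge_inf; [exact: JS.2|exists u].
have /choice[s sP] : forall n, exists u, S u /\ J u < m + n.+1%:R^-1.
  move=> n; have [|_ [u Su <-] Ju] := @inf_adherent _ _ n.+1%:R^-1 _ JS.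
    by rewrite invr_gt0.
  by exists u.
have Ss n : S (s n) by case: (sP n).
have [e e0|w Sw sw] := hcomplete_weak Ss.
  (* By the parallelogram law |s i - s j|^2 = 2 J (s i) + 2 J (s j) - 4 J (midpoint), which is below
     2 / (i + 1) + 2 / (j + 1) because [m] bounds [J] at the midpoint; hence e / 4. *)
  have [N _ NP] : \forall n \near \oo, n.+1%:R^-1 < e / 4.
    have e4 : 0 < e / 4 by rewrite divr_gt0.
    exact: (near_infty_natSinv_lt (PosNum e4)).
  exists N => i j Ni Nj.
  have Smid : S (2^-1 *: (s i + s j)) by apply: hsetZ; exact: hsetD.
  have := mJ _ Smid; have [_] := sP i; have [_] := sP j.
  have := NP _ Ni; have := NP _ Nj => /=.
  rewrite /J hdot_sqB// hdotZl ?hdotZr//; [|by try apply: hsetZ; exact: hsetD..].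
  have -> : phi (2^-1 *: (s i + s j)) = 2^-1 * (phi (s i) + phi (s j)).
    have p0 : phi 0 = 0.
      by have := phil 1 0 0 S0 S0; rewrite scale1r addr0 mul1r; lra.
    rewrite -[_ *: _]addr0 phil// ?p0 ?addr0; last exact: hsetD.
    by rewrite -[s i]scale1r phil// mul1r scale1r.
  rewrite hdotDl ?hdotDr//; last exact: hsetD.
  rewrite (hdot_sym hH (Ss j) (Ss i)).
  by move: i.+1%:R^-1 j.+1%:R^-1 => x y; lra.
exists w => // u Su.
have key n : (dot (s n) u - phi u) ^+ 2 <= n.+1%:R^-1 * dot u u.
  have [u0|/eqP u0] := eqVneq u 0.
    have p0 : phi 0 = 0.
      by have := phil 1 0 0 S0 S0; rewrite scale1r addr0 mul1r; lra.
    rewrite u0 p0 (hdot_sym hH (Ss n) S0) !hdot0l// subr0 expr0n mulr_ge0//.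
  have uu := hdot_gt0 hH Su u0.
  have [_] := sP n; set d := dot (s n) u - phi u => Jn.
  (* This [t] minimises [J (t *: u + s n)], which drops by [d ^+ 2 / dot u u] from [J (s n)] yet
     stays above the infimum [m]. *)
  pose t := - d / dot u u.
  have := mJ _ (hset_lin hH t Su (Ss n)).
  rewrite /J phil// hdotDl ?hdotDr ?hdotZl ?hdotZr//;
    try by [exact: hsetZ|apply: hset_lin].
  rewrite (hdot_sym hH Su (Ss n)) => h.
  have {h} : m <= J (s n) + 2 * t * d + t ^+ 2 * dot u u.
    by move: h; rewrite /J /d; lra.
  have -> : J (s n) + 2 * t * d + t ^+ 2 * dot u u = J (s n) - d ^+ 2 / dot u u.
    by rewrite /t; field; rewrite gt_eqF.
  by rewrite -ler_pdivrMr//; move: (d ^+ 2 / dot u u) n.+1%:R^-1 Jn => x y; lra.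
have d0 : dot (s n) u - phi u @[n --> \oo] --> dot w u - phi u.
  by apply: cvgB; [exact: sw|exact: cvg_cst].
have h0 : n.+1%:R^-1 * dot u u @[n --> \oo] --> 0.
  by rewrite -[X in _ --> X](mul0r (dot u u)); apply: cvgMl; exact: cvg_harmonic.
apply/eqP; rewrite -subr_eq0 -sqrf_eq0 eq_le sqr_ge0 andbT expr2.
by apply: (ler_cvg_to (cvgM d0 d0) h0); apply: nearW => n /=; rewrite -expr2.
Qed.

(** Induction on [r] for all [v] at once: removing the component along [e] keeps the coefficients on
    the rest and lowers the squared norm by exactly the square of the removed coefficient. *)
Lemma bessel (r : seq V) v : uniq r -> S v ->
  (forall e, e \in r -> S e) -> (forall e, e \in r -> dot e e = 1) ->
  (forall e f, e \in r -> f \in r -> e <> f -> dot e f = 0) ->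
  \sum_(e <- r) dot e v ^+ 2 <= dot v v.
Proof.
move=> + Sv; elim: r v Sv => [|e r IH] v Sv /=; first by rewrite big_nil hdot_ge0.
move=> /andP[er ur] Sr r1 r0; rewrite big_cons.
have Se : S e by apply: Sr; rewrite mem_head.
have ee : dot e e = 1 by apply: r1; rewrite mem_head.
pose w := v - dot e v *: e.
have Sev : S (dot e v *: e) by exact: hsetZ.
have Sw : S w by exact: hsetB.
have rS f : f \in r -> f \in e :: r by move=> fr; rewrite inE fr orbT.
have /(_ ur) := IH w Sw; rewrite (eq_big_seq (fun f => dot f v ^+ 2)).
  have -> : dot w w = dot v v - dot e v ^+ 2.
    by rewrite hdot_sqB// hdotZr// hdotZl// hdotZr// ee (hdot_sym hH Sv Se); ring.
  move=> h; rewrite addrC -lerBrDr; apply: h.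
  - by move=> f /rS /Sr.
  - by move=> f /rS /r1.
  - by move=> f g /rS fr /rS gr; exact: r0.
move=> f fr; rewrite hdotBr//; last exact/Sr/rS.
rewrite hdotZr//; last exact/Sr/rS.
rewrite (r0 f e) ?mulr0 ?subr0//; [exact: rS|exact: mem_head|].
by move=> fe; rewrite -fe fr in er.
Qed.

(* By Bessel, a vector has nonzero coefficients on countably many elements. *)
Lemma countable_orthonormal (E : set V) (v : nat -> V) :
  E `<=` S -> (forall e, E e -> dot e e = 1) ->
  (forall e f, E e -> E f -> e <> f -> dot e f = 0) ->
  (forall j, S (v j)) -> (forall u, S u -> (forall j, dot u (v j) = 0) -> u = 0) ->
  countable E.
Proof.
move=> ES E1 E0 Sv vT.
pose F j n := [set e | E e /\ n.+1%:R^-1 < dot e (v j) ^+ 2].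
suff : countable (\bigcup_j \bigcup_n F j n).
  apply: sub_countable; apply: subset_card_le => e Ee.
  have [j ej] : exists j, dot e (v j) != 0.
    apply: contrapT => /forallNP e0; have e00 : e = 0.
      by apply: vT => [|j]; [exact: ES|have := e0 j; move/negP; rewrite negbK => /eqP].
    have := E1 _ Ee; rewrite e00 hdot0l; last exact: hset0.
    by move=> /eqP; rewrite eq_sym oner_eq0.
  have ej2 : 0 < dot e (v j) ^+ 2 by rewrite exprn_even_gt0.
  have [N _ NP] := near_infty_natSinv_lt (PosNum ej2).
  by exists j => //; exists N => //; split => //; apply: NP => /=.
apply: bigcup_countable => // j _; apply: bigcup_countable => // n _.
apply: finite_set_countable; apply: contrapT => /infinite_set_fset Fj.
(* This many squared coefficients above 1 / (n + 1) add up to at least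
   [trunc (dot (v j) (v j)) + 1], which contradicts Bessel. *)
have [B BF sB] := Fj (n.+1 * (Num.trunc (dot (v j) (v j))).+1)%N.
have BE e : e \in finmap.enum_fset B -> E e /\ n.+1%:R^-1 < dot e (v j) ^+ 2.
  by move=> eB; apply: BF.
have := @bessel (finmap.enum_fset B) (v j) (finmap.fset_uniq B) (Sv j).
have BS e : e \in finmap.enum_fset B -> S e by move=> /BE[/ES].
have B1 e : e \in finmap.enum_fset B -> dot e e = 1 by move=> /BE[/E1].
move=> /(_ BS B1); apply/not_implyP; split.
  by move=> e f /BE[Ee _] /BE[Ef _]; exact: E0.
apply/negP; rewrite -ltNge.
apply: (lt_le_trans (truncnS_gt _)).
apply: (@le_trans _ _ (\sum_(e <- finmap.enum_fset B) n.+1%:R^-1)); last first.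
  by rewrite big_seq [leRHS]big_seq; apply: ler_sum => e /BE[_ /ltW].
rewrite big_const_seq count_predT iter_addr_0 -[leRHS]mulr_natr ler_pdivlMl//.
by rewrite -natrM ler_nat.
Qed.

(** [E] may be finite, or enumerated by a proper subset of the naturals, so [c] is padded with zero
    vectors. The third and fourth clauses replace orthonormality for a family whose members are unit
    vectors or zero; [g 0 = 0] makes the padding invisible in the series. *)
Lemma orthonormal_enum (E : set V) : E `<=` S -> countable E ->
  (forall e, E e -> dot e e = 1) ->
  (forall e f, E e -> E f -> e <> f -> dot e f = 0) ->
  exists c : nat -> V, [/\ forall n, S (c n),
    forall e, E e -> exists n, c n = e,
    forall i j, dot (c i) (c j) = (i == j)%:R * dot (c i) (c i),
    forall n u, S u -> dot u (c n) * dot (c n) (c n) = dot u (c n)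
    & forall g : V -> \bar R, (forall e, E e -> 0 <= g e)%E -> g 0 = 0%E ->
      \esum_(e in E) g e = (\sum_(i <oo) g (c i))%E].
Proof.
move=> ES /countable_bijP[B /card_set_bijP[f [fB fi fs]]] E1 E0.
pose c n := xget 0 [set e | E e /\ f e = n].
have cB n : B n -> E (c n) /\ f (c n) = n.
  by move=> /fs[e Ee en]; exact: (@xgetPex _ 0 [set e | E e /\ f e = n] (ex_intro _ e (conj Ee en))).
have fK e : E e -> c (f e) = e.
  by move=> Ee; have [Ec fc] := cB _ (fB _ Ee); apply: fi => //; rewrite inE.
have S0 := hset0 hH.
have c0 n : ~ B n -> c n = 0.
  by move=> nB; apply: xgetPN => e [/fB + en]; rewrite en.
have cS n : S (c n).
  by have [/cB[/ES]//|/c0 ->] := pselect (B n).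
exists c; split => //.
- by move=> e Ee; exists (f e); exact: fK.
- move=> i j; have [->|ij] := eqVneq i j; first by rewrite mul1r.
  rewrite mul0r.
  have [/cB[Ei fci]|/c0 ->] := pselect (B i); last by rewrite hdot0l.
  have [/cB[Ej fcj]|/c0 ->] := pselect (B j); last by rewrite (hdot_sym hH)// hdot0l.
  by apply: E0 => // cij; move: ij; rewrite -fci -fcj cij eqxx.
- move=> n u Su; have [/cB[En _]|/c0 ->] := pselect (B n).
    by rewrite (E1 _ En) mulr1.
  by rewrite (hdot_sym hH Su S0) hdot0l// mul0r.
- move=> g g0 g00.
  have -> : \esum_(e in E) g e = \esum_(e in E) g (c (f e)).
    by apply: eq_esum => e Ee; rewrite fK.
  rewrite -(@reindex_esum _ _ _ E B f (g \o c))//.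
  rewrite esum_mkcond nneseries_esumT; last first.
    by move=> n; have [/cB[/g0]//|/c0 ->] := pselect (B n); rewrite g00.
  by apply: eq_esum => i _; rewrite /=; case: ifPn => //; rewrite notin_setE => /c0 ->.
Qed.

Section parseval.
Variable c : nat -> V.
Hypothesis Sc : forall n, S (c n).
Hypothesis c_orth : forall i j, dot (c i) (c j) = (i == j)%:R * dot (c i) (c i).
Hypothesis c_idem : forall n u, S u -> dot u (c n) * dot (c n) (c n) = dot u (c n).
Hypothesis c_total : forall u, S u -> (forall n, dot u (c n) = 0) -> u = 0.

Let proj u n := \sum_(i < n) dot u (c i) *: c i.

Let Sproj u n : S (proj u n).
Proof. by apply: hset_sum => i _; exact: hsetZ. Qed.

Let dot_proj u v n : S v ->
  dot (proj u n) v = \sum_(i < n) dot u (c i) * dot v (c i).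
Proof.
move=> Sv; rewrite hdot_suml//; last by move=> i; exact: hsetZ.
by apply: eq_bigr => i _; rewrite hdotZl// (hdot_sym hH (Sc i) Sv).
Qed.

Let dot_proj_c u n j : S u -> dot (proj u n) (c j) = (j < n)%:R * dot u (c j).
Proof.
move=> Su; rewrite dot_proj//.
under eq_bigr => i _ do rewrite c_orth.
have [jn|nj] := ltnP j n.
  rewrite (bigD1 (Ordinal jn))//= eqxx !mul1r c_idem// big1 ?addr0// => i ij.
  suff /negbTE -> : j != i by rewrite mul0r mulr0.
  by apply: contra ij => /eqP ji; apply/eqP/val_inj.
rewrite mul0r big1// => i _; have /negbTE -> : j != i.
  by rewrite gtn_eqF// (leq_trans (ltn_ord i)).
by rewrite mul0r mulr0.
Qed.

Let dot_proj_proj u m n : S u -> (m <= n)%N ->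
  dot (proj u m) (proj u n) = \sum_(i < m) dot u (c i) ^+ 2.
Proof.
move=> Su mn; rewrite dot_proj//; apply: eq_bigr => i _.
by rewrite dot_proj_c// (leq_trans _ mn)// mul1r -expr2.
Qed.

Lemma bessel_enum u n : S u -> \sum_(i < n) dot u (c i) ^+ 2 <= dot u u.
Proof.
move=> Su; have := hdot_ge0 (hsetB Su (Sproj u n)).
rewrite hdot_sqB// dot_proj_proj// (hdot_sym hH Su)// dot_proj//.
by under eq_bigr do rewrite -expr2; lra.
Qed.

(** By Bessel the sums of squared coefficients converge, so the partial projections of [u] are
    Cauchy. Their limit has the same coefficients as [u], hence equals [u] by totality. *)
Lemma parseval u v : S u -> S v ->
  \sum_(i < n) dot u (c i) * dot v (c i) @[n --> \oo] --> dot u v.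
Proof.
move=> Su Sv; pose a n := \sum_(i < n) dot u (c i) ^+ 2.
have a_nd : nondecreasing_seq a.
  apply/nondecreasing_seqP => n; rewrite /a big_ord_recr/= lerDl; exact: sqr_ge0.
have ca : cvgn a.
  apply: nondecreasing_is_cvgn => //; exists (dot u u) => _ [n _ <-].
  exact: bessel_enum.
have aL n : a n <= limn a by exact: nondecreasing_cvgn_le.
have [e e0|w Sw uw] := hcomplete_weak (Sproj u).
  have /cvgrPdist_lt/(_ _ e0)[N _ NP] := ca.
  exists N => m n; wlog mn : m n / (m <= n)%N => [H0|Nm Nn].
    have [/H0//|/ltnW nm Nm Nn] := leqP m n; have := H0 _ _ nm Nn Nm.
    by rewrite !hdot_sqB// (hdot_sym hH (Sproj u n) (Sproj u m)); lra.
  rewrite hdot_sqB// !dot_proj_proj//.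
  have := NP _ Nm; rewrite /= ger0_norm ?subr_ge0//.
  by have := aL n; rewrite /a; lra.
suff uEw : u = w.
  by have := uw v Sv; rewrite -uEw; under eq_cvg do rewrite dot_proj//.
apply/eqP; rewrite -subr_eq0; apply/eqP/c_total => [|j]; first exact: hsetB.
apply/eqP; rewrite hdotBl// subr_eq0; apply/eqP.
have uc : dot (proj u n) (c j) @[n --> \oo] --> dot u (c j).
  by apply: cvg_near_cst; exists j.+1 => // n /= jn; rewrite dot_proj_c// jn mul1r.
by rewrite -(cvg_lim (@Rhausdorff R) uc) -(cvg_lim (@Rhausdorff R) (uw _ (Sc j))).
Qed.
End parseval.

End hilbert_theory.

Section hpow_theory.
Context {R : realType} {X : Type}.
Variable H : hspace (X -> R^o).
Hypothesis hH : is_hilbert H.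
Variable d : nat.
Local Notation comp F i := (fun x => F x 0 i : R^o).
Implicit Types F G : X -> 'rV[R]_d.

Let comp_lin a F G i : comp (a *: F + G) i = a *: (comp F i : X -> R^o) + comp G i.
Proof. by apply/funext => x; rewrite /GRing.add /GRing.scale /= !mxE. Qed.

Let compB F G i : comp (F - G) i = (comp F i : X -> R^o) - comp G i.
Proof. by apply/funext => x; rewrite /GRing.add /GRing.opp /= !mxE. Qed.

Let comp0 i : comp (0 : X -> 'rV[R]_d) i = 0.
Proof. by apply/funext => x; rewrite mxE. Qed.

Lemma hpow_is_hilbert : is_hilbert (hpow H d).
Proof.
split => /=.
- by move=> i; rewrite comp0; exact: hset0.
- by move=> a F G SF SG i; rewrite comp_lin; exact: hset_lin.
- by move=> F G SF SG; apply: eq_bigr => i _; rewrite (hdot_sym hH (SF i) (SG i)).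
- move=> a F G K SF SG SK; rewrite mulr_sumr -big_split/=; apply: eq_bigr => i _.
  by rewrite comp_lin (hdot_lin hH a (SF i) (SG i) (SK i)).
- move=> F SF F0; rewrite lt_neqAle sumr_ge0 ?andbT; last first.
    by move=> i _; exact: (hdot_ge0 hH (SF i)).
  apply/negP => /eqP/esym/psumr_eq0P F00; apply: F0; apply/funext => x.
  apply/rowP => i; rewrite mxE.
  have := F00 (fun i _ => hdot_ge0 hH (SF i)) i isT.
  by move/(hdot_eq0 hH (SF i))/(congr1 (@^~ x)).
move=> s Ss sC.
have le_comp F i : (forall i, hset H (comp F i)) ->
    hnorm H (comp F i) <= hnorm (hpow H d) F.
  move=> SF; rewrite ler_wsqrtr//= (bigD1 i)//= lerDl sumr_ge0// => j _.
  exact: (hdot_ge0 hH (SF j)).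
have /choice[u uP] : forall i, exists u : X -> R^o,
    hset H u /\ hnorm H (comp (s n) i - u) @[n --> \oo] --> (0 : R).
  move=> i; have [|u Su su] := hcomplete hH (fun n => Ss n i).
    move=> e e0; have [N NP] := sC e e0; exists N => m n Nm Nn.
    apply: le_lt_trans (NP m n Nm Nn); rewrite -compB; apply: le_comp => j.
    by rewrite compB; exact: (hsetB hH (Ss m j) (Ss n j)).
  by exists u.
exists (fun x => \row_i u i x).
  move=> i; have [Su _] := uP i; congr (hset H _) : Su.
  by apply/funext => x; rewrite mxE.
have -> : (fun n => hnorm (hpow H d) (s n - (fun x => \row_i u i x))) =
    Num.sqrt \o (fun n => \sum_(i < d) hnorm H (comp (s n) i - u i) ^+ 2).
  apply/funext => n /=; congr Num.sqrt; apply: eq_bigr => i _.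
  have -> : comp (s n - (fun x => \row_i u i x)) i = comp (s n) i - u i.
    by apply/funext => x; rewrite /GRing.add /GRing.opp /= !mxE.
  by rewrite sqr_sqrtr// hdot_ge0//; apply: (hsetB hH (Ss n i)); have [] := uP i.
rewrite -[X in _ --> X]sqrtr0; apply: continuous_cvg; first exact: sqrt_continuous.
rewrite -[X in _ --> X](@big1_eq _ _ +%R _ (index_enum 'I_d) predT).
apply: cvg_sumr => i; rewrite -[X in _ --> X](expr0n _ 2).
under eq_cvg do rewrite expr2; rewrite expr2; apply: cvgM; exact: (uP i).2.
Qed.

(** With [f] a kernel section this is the reproducing property of H^d: the pairing evaluates one
    entry at one point. *)
Lemma hpow_dot_delta F (f : X -> R^o) i : hset (hpow H d) F -> hset H f ->
  hdot (hpow H d) F (fun x => f x *: delta_mx 0 i) = hdot H (comp F i) f.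
Proof.
move=> SF Sf; rewrite /= (bigD1 i)//= big1 ?addr0.
  congr hdot; apply/funext => x; rewrite !mxE !eqxx mulr1//.
move=> j ij; have -> : comp (fun x => f x *: delta_mx 0 i : 'rV[R]_d) j = 0.
  by apply/funext => x; rewrite !mxE (negbTE ij) andbF mulr0.
by rewrite (hdot_sym hH (SF j) (hset0 hH)) hdot0l//; exact: SF.
Qed.

Lemma hset_delta (f : X -> R^o) i : hset H f ->
  hset (hpow H d) (fun x => f x *: delta_mx 0 i).
Proof.
move=> Sf j; have := hsetZ hH (j == i)%:R Sf; congr (hset H _).
by apply/funext => x; rewrite !mxE eqxx mulrC.
Qed.

End hpow_theory.

(** * Covariance operators *)

Section Rintegral_extra.
Context d {T : measurableType d} {R : realType}.
Variable mu : {measure set T -> \bar R}.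
Implicit Types f g : T -> R.

Lemma EFin_Rintegral f : mu.-integrable setT (EFin \o f) ->
  (\int[mu]_x f x)%:E = (\int[mu]_x (f x)%:E)%E.
Proof. by move=> mf; rewrite /Rintegral fineK//; exact: integrable_fin_num. Qed.

Lemma Rintegral_sum (I : Type) (r : seq I) (f : I -> T -> R) :
  (forall i, mu.-integrable setT (EFin \o f i)) ->
  mu.-integrable setT (EFin \o (fun x => \sum_(i <- r) f i x)) /\
  \int[mu]_x (\sum_(i <- r) f i x) = \sum_(i <- r) \int[mu]_x f i x.
Proof.
move=> fi; elim: r => [|i r [IH1 IH2]].
  rewrite big_nil; under eq_Rintegral do rewrite big_nil.
  rewrite /Rintegral integral0; split => //.
  by apply: eq_integrable (integrable0 _ _) => // x _ /=; rewrite big_nil.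
rewrite big_cons -IH2 -RintegralD//; split.
  by apply: eq_integrable (integrableD _ (fi i) IH1) => // x _ /=; rewrite big_cons.
by apply: eq_Rintegral => x _; rewrite big_cons.
Qed.

Lemma ler_integrable f g : measurable_fun setT f -> (forall x, `|f x| <= g x) ->
  mu.-integrable setT (EFin \o g) -> mu.-integrable setT (EFin \o f).
Proof.
move=> mf fg; apply: le_integrable => //; first exact/measurable_EFinP.
by move=> x _ /=; rewrite lee_fin (le_trans (fg x))// ler_norm.
Qed.

Lemma integrableZl_fin f (a : R) : mu.-integrable setT (EFin \o f) ->
  mu.-integrable setT (EFin \o (fun x => a * f x)).
Proof. by move=> fi; apply: (integrableZl measurableT a fi). Qed.

Lemma integrableD_fin f g : mu.-integrable setT (EFin \o f) ->
  mu.-integrable setT (EFin \o g) -> mu.-integrable setT (EFin \o (fun x => f x + g x)).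
Proof. by move=> fi gi; apply: eq_integrable (integrableD _ fi gi). Qed.

End Rintegral_extra.

Section covariance_operator.
Context {R : realType} {V : lmodType R} (H : hspace V).
Hypothesis hH : is_hilbert H.
Local Notation S := (hset H).
Local Notation dot := (hdot H).
Context dT {T : measurableType dT} (P : {measure set T -> \bar R}) (xi : T -> V).
Hypothesis Sxi : forall t, S (xi t).
Hypothesis mxi : forall F, S F -> measurable_fun setT (fun t => dot (xi t) F).
Hypothesis ixi : P.-integrable setT (EFin \o (fun t => dot (xi t) (xi t))).
Implicit Types F G : V.

Let M := \int[P]_t dot (xi t) (xi t).

Let M0 : 0 <= M.
Proof. by apply: Rintegral_ge0 => t _; exact: hdot_ge0. Qed.

Let norm_dot2 F G t : S F -> S G -> `|dot (xi t) F * dot (xi t) G| <=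
  Num.sqrt (dot F F * dot G G) * dot (xi t) (xi t).
Proof.
move=> SF SG; rewrite -sqrtr_sqr -[X in _ <= _ * X]ger0_norm ?hdot_ge0//.
rewrite -(@sqrtr_sqr _ (dot (xi t) (xi t))) -sqrtrM; last first.
  by rewrite mulr_ge0// hdot_ge0.
rewrite ler_wsqrtr// exprMn.
have := ler_pM (sqr_ge0 _) (sqr_ge0 _) (cauchy_schwarz hH (Sxi t) SF)
  (cauchy_schwarz hH (Sxi t) SG).
by move=> /le_trans -> //; rewrite expr2 mulrACA mulrC.
Qed.

Lemma integrable_dot2 F G : S F -> S G ->
  P.-integrable setT (EFin \o (fun t => dot (xi t) F * dot (xi t) G)).
Proof.
move=> SF SG; apply: (ler_integrable _ (fun t => norm_dot2 t SF SG)).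
  by apply: measurable_funM; exact: mxi.
exact: integrableZl_fin.
Qed.

Let phi F G := \int[P]_t (dot (xi t) F * dot (xi t) G).

Let phi_sqr F G : S F -> S G -> phi F G ^+ 2 <= M ^+ 2 * dot F F * dot G G.
Proof.
move=> SF SG; have FG0 : 0 <= dot F F * dot G G by rewrite mulr_ge0// hdot_ge0.
rewrite -mulrA -(sqr_sqrtr FG0) -exprMn -(real_normK (num_real (phi F G))).
rewrite ler_pXn2r ?nnegrE ?mulr_ge0 ?sqrtr_ge0//.
apply: (le_trans (le_normr_Rintegral _ (integrable_dot2 SF SG))) => //.
rewrite mulrC -RintegralZl//; apply: le_Rintegral => //.
- exact: (integrable_norm (integrable_dot2 SF SG)).
- exact: integrableZl_fin.
- by move=> t _; exact: norm_dot2.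
Qed.

(** The expectation of the rank-one operators in its weak (Pettis) form: Cauchy-Schwarz bounds the
    bilinear form by [M], the mean of |xi|^2, so Riesz represents it. *)
Lemma covariance_representer F : S F ->
  exists2 w, S w & forall G, S G -> dot w G = \int[P]_t (dot (xi t) F * dot (xi t) G).
Proof.
move=> SF; apply: (@riesz _ _ _ hH (phi F) (M ^+ 2 * dot F F)) => [a u v Su Sv|u Su].
  rewrite /phi -RintegralZl//; last exact: integrable_dot2.
  rewrite -RintegralD//; last 2 first.
  - by apply: integrableZl_fin; exact: integrable_dot2.
  - exact: integrable_dot2.
  apply: eq_Rintegral => t _; rewrite (hdotDr hH)//; last exact: hsetZ.
  by rewrite (hdotZr hH)//; ring.
exact: phi_sqr.
Qed.

Section trace.
Variables (C : V -> V) (E : set V).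
Hypothesis SC : forall F, S F -> S (C F).
Hypothesis CE : forall F G, S F -> S G ->
  dot (C F) G = \int[P]_t (dot (xi t) F * dot (xi t) G).
Hypothesis hE : orthonormal_basis H E.
Hypothesis cE : countable E.

Let C_sym F G : S F -> S G -> dot (C F) G = dot F (C G).
Proof.
move=> SF SG; rewrite CE// (hdot_sym hH SF (SC SG)) CE//.
by under eq_Rintegral do rewrite mulrC.
Qed.

(** Taking [G = C F] in the bound on the form gives x^2 <= M^2 |F|^2 x with x = |C F|^2, and one
    factor x cancels. *)
Let C_bound F : S F -> dot (C F) (C F) <= M ^+ 2 * dot F F.
Proof.
move=> SF; have := phi_sqr SF (SC SF); rewrite /phi -CE//; last exact: SC.
have := hdot_ge0 hH (SC SF); rewrite le_eqVlt => /predU1P[<- _|x0].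
  by rewrite mulr_ge0 ?sqr_ge0 ?hdot_ge0.
by rewrite expr2 ler_pM2r.
Qed.

Lemma trace_covariance : trace H E C = \int[P]_t dot (xi t) (xi t).
Proof.
case: hE => ES E1 E0 Etot.
have [c [Sc Ec c_orth c_idem esumE]] := orthonormal_enum hH ES cE E1 E0.
have c_tot u : S u -> (forall n, dot u (c n) = 0) -> u = 0.
  by move=> Su u0; apply: Etot => // e /Ec[n <-].
have S0 := hset0 hH.
rewrite /trace esumE; last 2 first.
- move=> e /ES Se; rewrite lee_fin (hdot_sym hH Se (SC Se)) CE//.
  by apply: Rintegral_ge0 => t _; rewrite -expr2 sqr_ge0.
- by rewrite hdot0l//; exact: SC.
congr fine.
transitivity (\sum_(i <oo) \int[P]_t (dot (xi t) (c i) ^+ 2)%:E)%E.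
  apply: eq_eseriesr => i _; rewrite (hdot_sym hH (Sc i) (SC (Sc i))) CE//.
  by rewrite EFin_Rintegral//; exact: integrable_dot2.
rewrite -integral_nneseries//; last 2 first.
- by move=> i; apply/measurable_EFinP; apply: measurable_funX; exact: mxi.
- by move=> i t _; rewrite lee_fin sqr_ge0.
apply: eq_integral => t _; apply/cvg_lim => //.
rewrite (_ : (fun n => _) = EFin \o (fun n => \sum_(i < n) dot (xi t) (c i) * dot (xi t) (c i))).
  by apply: cvg_EFin; [exact: nearW|exact: (parseval hH Sc c_orth c_idem c_tot)].
by apply/funext => n /=; rewrite sumEFin big_mkord.
Qed.

(* Dominated convergence in one variable suffices, because
   [dot (C (C e)) e] is the integral of [dot (xi s) e * dot (C (xi s)) e]. *)
Lemma trace_covariance_sqr : trace H E (C \o C) =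
  \int[P]_s \int[P]_t (dot (xi s) (xi t) ^+ 2).
Proof.
case: hE => ES E1 E0 Etot.
have [c [Sc Ec c_orth c_idem esumE]] := orthonormal_enum hH ES cE E1 E0.
have c_tot u : S u -> (forall n, dot u (c n) = 0) -> u = 0.
  by move=> Su u0; apply: Etot => // e /Ec[n <-].
have S0 := hset0 hH.
have CCE e : S e -> dot e (C (C e)) = dot (C e) (C e).
  by move=> Se; rewrite -C_sym//; exact: SC.
rewrite /trace esumE; last 2 first.
- by move=> e /ES Se; rewrite lee_fin CCE// hdot_ge0//; exact: SC.
- by rewrite hdot0l//; exact/SC/SC.
pose f i s := dot (xi s) (c i) * dot (C (xi s)) (c i).
have fE i s : f i s = dot (xi s) (c i) * dot (xi s) (C (c i)) by rewrite /f C_sym.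
have fi i : P.-integrable setT (EFin \o f i).
  rewrite (_ : f i = fun s => dot (xi s) (c i) * dot (xi s) (C (c i))).
    by apply: integrable_dot2 => //; exact: SC.
  by apply/funext => s; exact: fE.
have cvgf s : \sum_(i < n) f i s @[n --> \oo] --> dot (xi s) (C (xi s)).
  by apply: (parseval hH Sc c_orth c_idem c_tot) => //; exact: SC.
have mf n : measurable_fun setT (fun s => \sum_(i < n) f i s).
  by have [/measurable_int/measurable_EFinP] := Rintegral_sum (index_enum 'I_n) fi.
(* The dominating function: |a b| <= (a^2 + b^2) / 2 on each term, then Bessel for [xi s] and for
   [C (xi s)], then the operator bound [M ^+ 2]. *)
pose g s := 2^-1 * (1 + M ^+ 2) * dot (xi s) (xi s).
have fg s n : `|\sum_(i < n) f i s| <= g s.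
  have SCxi := SC (Sxi s).
  apply: (le_trans (ler_norm_sum _ _ _)).
  apply: (@le_trans _ _ (\sum_(i < n) 2^-1 * (dot (xi s) (c i) ^+ 2 +
      dot (C (xi s)) (c i) ^+ 2))).
    apply: ler_sum => i _; rewrite ler_norml /f.
    move: (dot (xi s) _) (dot (C (xi s)) _) => a b.
    by have := sqr_ge0 (a - b); have := sqr_ge0 (a + b); nra.
  rewrite -mulr_sumr big_split/= /g -mulrA ler_pM2l// mulrDl mul1r.
  apply: lerD; first exact: (bessel_enum hH Sc c_orth c_idem).
  apply: le_trans (C_bound (Sxi s)).
  exact: (bessel_enum hH Sc c_orth c_idem).
have ae1 : {ae P, forall s, setT s ->
    (fun n => (\sum_(i < n) f i s)%:E) @ \oo --> (dot (xi s) (C (xi s)))%:E}.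
  by apply/aeW => s _; apply: cvg_EFin; [exact: nearW|exact: cvgf].
have ae2 : {ae P, forall s n, setT s -> (`|(\sum_(i < n) f i s)%:E| <= (g s)%:E)%E}.
  by apply/aeW => s n _; rewrite lee_fin.
have [|||_ _ lim_int] := @dominated_convergence _ _ _ P setT measurableT
  (fun n s => (\sum_(i < n) f i s)%:E) (fun s => (dot (xi s) (C (xi s)))%:E)
  (fun s => (g s)%:E) _ _ ae1 _ ae2.
- by move=> n; apply/measurable_EFinP.
- apply/measurable_EFinP; apply: (measurable_fun_cvg mf) => s _; exact: cvgf.
- exact: integrableZl_fin.
congr fine.
transitivity (\int[P]_s (dot (xi s) (C (xi s)))%:E)%E.
  apply/cvg_lim => //; apply: (cvg_trans _ lim_int); apply: near_eq_cvg.
  apply: nearW => n /=.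
  rewrite big_mkord -EFin_Rintegral; last exact: (Rintegral_sum (index_enum 'I_n) fi).1.
  rewrite (Rintegral_sum (index_enum 'I_n) fi).2 -sumEFin; apply: eq_bigr => i _.
  rewrite CCE// CE//; last exact: SC.
  by congr EFin; apply: eq_Rintegral => s _; rewrite fE.
apply: eq_integral => s _; rewrite (hdot_sym hH (Sxi s) (SC (Sxi s))) CE//.
congr EFin; apply: eq_Rintegral => t _.
by rewrite (hdot_sym hH (Sxi t) (Sxi s)) -expr2.
Qed.
End trace.

End covariance_operator.

(** * The Stein kernel of a Gaussian kernel *)

Section directional_derivative.
Context {R : realType}.
Implicit Types (F : R -> R).

(** Along a coordinate line the log-density, the kernel and the entries of the Stein feature all
    have this shape, so one derivative at 0 serves them all. *)
Lemma is_derive_expR_quad (a b c p q r : R) :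
  is_derive (0 : R) 1
    (fun h => expR (a + b * h + c * h ^+ 2) * (p + q * h + r * h ^+ 2))
    (expR a * (b * p + q)).
Proof.
have quad u v w : is_derive (0 : R) 1 (fun h => u + v * h + w * h ^+ 2) v.
  rewrite (_ : (fun h => _) = cst u + v *: id + w *: (id ^+ 2)); last first.
    by apply/funext => h; rewrite !fctE.
  apply: is_derive_eq; rewrite /= expr1 /GRing.scale/=; ring.
have dexp : is_derive (0 : R) 1 (expR \o (fun h => a + b * h + c * h ^+ 2)) (expR a * b).
  apply: is_derive1_comp; rewrite [X in is_derive X](_ : _ = a).
    exact: is_derive_expR.
  by rewrite !mulr0 expr0n mulr0 !addr0.
have [D1 D2] := is_deriveM dexp (quad p q r); apply: DeriveDef; first exact: D1.
rewrite [LHS]D2/= !mulr0 expr0n !mulr0 !addr0 /GRing.scale/=; ring.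
Qed.

Lemma derive_row d (f : 'rV[R]_d -> R) (x : 'rV[R]_d) i F df :
  (forall h, f (h *: 'e_i + x) = F h) -> is_derive (0 : R) 1 F df ->
  'D_('e_i) f x = df.
Proof.
move=> fF [_ <-]; rewrite /derive.
suff -> : (fun h => h^-1 *: ((f \o shift x) (h *: 'e_i) - f x)) =
  (fun h => h^-1 *: ((F \o shift 0) (h *: 1) - F 0)) by [].
apply/funext => h /=; have -> : f x = F 0 by rewrite -fF scale0r add0r.
by rewrite fF addr0 [h *: 1]mulr1.
Qed.

Lemma cvg_diffquot F df : is_derive (0 : R) 1 F df ->
  n.+1%:R * (F n.+1%:R^-1 - F 0) @[n --> \oo] --> df.
Proof.
case=> dF <-.
have h0 : (fun n => n.+1%:R^-1 : R) @ \oo --> 0^'.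
  move=> A [e e0 eA]; have [N _ NP] := near_infty_natSinv_lt (PosNum e0).
  exists N => // n /NP /= ne; apply: eA => /=; last by rewrite invr_eq0 pnatr_eq0.
  by rewrite sub0r normrN ger0_norm.
apply: cvg_trans (cvg_comp _ _ h0 dF); apply: near_eq_cvg; apply: nearW => n /=.
by rewrite invrK /GRing.scale/= mulr1 addr0.
Qed.

End directional_derivative.

(* Divided by [h * l], the middle term is the inner product of the difference
   quotients of the kernel with steps [h] and [l]. Writing it as
   [p q (exp (2 g h l) - 1) + (1 - p) (1 - q)] with [p = exp (- g h^2)] and
   [q = exp (- g l^2)] keeps every error term a multiple of [h * l]. *)
Lemma expR_diffquot_bounds {R : realType} (g h l : R) : 0 <= g -> 0 <= h -> 0 <= l ->
  2 * g * h * l * (1 - g * (h ^+ 2 + l ^+ 2)) <=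
  expR (- g * (h - l) ^+ 2) - expR (- g * h ^+ 2) - expR (- g * l ^+ 2) + 1 <=
  2 * g * h * l + g ^+ 2 * h ^+ 2 * l ^+ 2.
Proof.
move=> g0 h0 l0; have hl0 : 0 <= g * h * l by rewrite !mulr_ge0.
have e1 x : 1 + x <= expR x :> R by exact: expR_ge1Dx.
have eN x : expR x * (1 - x) <= 1 :> R.
  have := e1 (- x); have := expR_gt0 x => /ltW ex.
  by move=> /(ler_wpM2l ex); rewrite -expRD subrr expR0.
set p := expR (- g * h ^+ 2); set q := expR (- g * l ^+ 2).
have -> : expR (- g * (h - l) ^+ 2) = p * q * expR (2 * (g * h * l)).
  by rewrite -!expRD; congr expR; ring.
set e := expR _.
have p0 : 0 <= p by exact: expR_ge0.
have q0 : 0 <= q by exact: expR_ge0.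
have p1 : 1 - p <= g * h ^+ 2 by have := e1 (- g * h ^+ 2); rewrite -/p; lra.
have q1 : 1 - q <= g * l ^+ 2 by have := e1 (- g * l ^+ 2); rewrite -/q; lra.
have p2 : 0 <= 1 - p by rewrite subr_ge0 expR_le1 mulNr oppr_le0 mulr_ge0// sqr_ge0.
have q2 : 0 <= 1 - q by rewrite subr_ge0 expR_le1 mulNr oppr_le0 mulr_ge0// sqr_ge0.
have pq1 : 1 - g * (h ^+ 2 + l ^+ 2) <= p * q.
  by rewrite -expRD; have := e1 (- g * h ^+ 2 + - g * l ^+ 2); lra.
(* [p * q * e] is exp (- g (h - l)^2), hence at most 1; this absorbs the factor [e] in e - 1 <= 2 g
   h l e. *)
have pqe1 : p * q * e <= 1.
  rewrite -!expRD expR_le1.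
  have := mulr_ge0 g0 (sqr_ge0 (h - l)); lra.
have pqe : p * q * (e - 1) <= 2 * (g * h * l).
  have : e - 1 <= 2 * (g * h * l) * e by have := eN (2 * (g * h * l)); rewrite -/e; lra.
  move/(ler_wpM2l (mulr_ge0 p0 q0)) => /le_trans; apply.
  have := ler_wpM2l hl0 pqe1; lra.
have pqe' : p * q * (2 * (g * h * l)) <= p * q * (e - 1).
  by apply: ler_wpM2l; [exact: mulr_ge0|have := e1 (2 * (g * h * l)); rewrite -/e; lra].
apply/andP; split.
  have := ler_wpM2l hl0 pq1; have := mulr_ge0 p2 q2; lra.
have := ler_pM p2 q2 p1 q1; lra.
Qed.

Section stein_kernel.
Context {R : realType} (d : nat) (gamma : R).
Hypothesis gamma0 : 0 < gamma.
Local Notation k := (@gauss_kernel R d gamma).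
Implicit Types x y z : 'rV[R]_d.

Lemma sqnorm_shift x i h : sqnorm (h *: 'e_i + x) = sqnorm x + 2 * h * x 0 i + h ^+ 2.
Proof.
rewrite /sqnorm (bigD1 i)//= [in RHS](bigD1 i)//= !mxE !eqxx mulr1.
rewrite (eq_bigr (fun j => x 0 j ^+ 2)); first by ring.
by move=> j ij; rewrite !mxE (negbTE ij) andbF mulr0 add0r.
Qed.

Lemma sqnormN x : sqnorm (- x) = sqnorm x.
Proof. by apply: eq_bigr => i _; rewrite mxE sqrrN. Qed.

Lemma sqnorm0 : sqnorm (0 : 'rV[R]_d) = 0.
Proof. by rewrite /sqnorm big1// => i _; rewrite mxE expr0n. Qed.

Lemma gauss_kernelC x y : k x y = k y x.
Proof. by rewrite /gauss_kernel -sqnormN opprB. Qed.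

Lemma gauss_kernel_diag x : k x x = 1.
Proof. by rewrite /gauss_kernel subrr sqnorm0 mulr0 expR0. Qed.

Lemma gauss_kernel_shift x y i h : k (h *: 'e_i + x) y =
  k x y * expR (- 2 * gamma * (x 0 i - y 0 i) * h - gamma * h ^+ 2).
Proof.
rewrite /gauss_kernel -addrA sqnorm_shift -expRD !mxE; congr expR; ring.
Qed.

Lemma score_gaussian x : score (@gaussian_density R d) x = - x.
Proof.
apply/rowP => i; rewrite mxE [RHS]mxE.
pose c : R := (2 * pi) `^ (- (d%:R / 2)).
have c0 : 0 < c by rewrite powR_gt0// mulr_gt0// pi_gt0.
apply: (@derive_row _ _ _ _ _ (fun h => expR (0 + 0 * h + 0 * h ^+ 2) *
    (ln c - sqnorm x / 2 + (- x 0 i) * h + (- 2^-1) * h ^+ 2))).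
  move=> h; rewrite lnM ?posrE ?expR_gt0// expRK sqnorm_shift -/c !mul0r !addr0 expR0.
  by rewrite mul1r; field.
have := is_derive_expR_quad 0 0 0 (ln c - sqnorm x / 2) (- x 0 i) (- 2^-1).
by rewrite expR0 mul0r add0r mul1r.
Qed.

Definition dkernel x i : 'rV[R]_d -> R^o :=
  fun y => - 2 * gamma * (x 0 i - y 0 i) * k x y.

Lemma is_derive_kernel x y i :
  is_derive (0 : R) 1 (fun h => k (h *: 'e_i + x) y) (dkernel x i y).
Proof.
have := is_derive_expR_quad 0 (- 2 * gamma * (x 0 i - y 0 i)) (- gamma) (k x y) 0 0.
congr (is_derive (0 : R) (1 : R) _ _).
  apply/funext => h; rewrite gauss_kernel_shift mulrC !mul0r !addr0 add0r.
  by rewrite (mulNr gamma).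
by rewrite /dkernel expR0 mul1r addr0.
Qed.

Lemma grad_kernel x y : grad (fun z => k z y) x = \row_i dkernel x i y.
Proof.
by apply/rowP => i; rewrite !mxE; apply: derive_row (is_derive_kernel x y i).
Qed.

Lemma stein_feature_gauss x y i :
  stein_feature (@gaussian_density R d) k x y 0 i =
  - x 0 i * k x y + dkernel x i y.
Proof. by rewrite /stein_feature score_gaussian grad_kernel !mxE; ring. Qed.

(** The Langevin-Stein kernel, kept as a sum over coordinates so that Gaussian integrals of it and
    of its square factor. *)
Definition stein_kernel x y : R := k x y * \sum_(i < d)
  (x 0 i * y 0 i - (2 * gamma + 4 * gamma ^+ 2) * (x 0 i - y 0 i) ^+ 2 + 2 * gamma).

Section rkhs.
Variable H : hspace ('rV[R]_d -> R^o).
Hypothesis Hk : is_rkhs k H.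
Local Notation S := (hset H).
Local Notation dot := (hdot H).
Let hH : is_hilbert H. Proof. by case: Hk. Qed.
Let Sk x : S (k x). Proof. by case: Hk. Qed.
Let repro f x : S f -> dot f (k x) = f x. Proof. by case: Hk => _ _; apply. Qed.

Let kdq x i n : 'rV[R]_d -> R^o :=
  n.+1%:R *: ((k (n.+1%:R^-1 *: 'e_i + x) : _ -> R^o) - k x).

Let Skdq x i n : S (kdq x i n).
Proof. by apply: (hsetZ hH); exact: (hsetB hH). Qed.

Let dot_kdq x i m n : dot (kdq x i m) (kdq x i n) = m.+1%:R * n.+1%:R *
  (expR (- gamma * (m.+1%:R^-1 - n.+1%:R^-1) ^+ 2) - expR (- gamma * m.+1%:R^-1 ^+ 2)
   - expR (- gamma * n.+1%:R^-1 ^+ 2) + 1).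
Proof.
set h := m.+1%:R^-1; set l := n.+1%:R^-1.
have SB a : S ((k (a *: 'e_i + x) : _ -> R^o) - k x) by exact: (hsetB hH).
rewrite /kdq (hdotZl hH _ (SB h) (hsetZ hH _ (SB l))) (hdotZr hH _ (SB l) (SB h)).
rewrite mulrA; congr (_ * _).
rewrite (hdotBl hH (Sk _) (Sk x) (SB l)) !(hdotBr hH (Sk _) (Sk x) (Sk _)) !repro// gauss_kernel_diag.
rewrite (gauss_kernelC x) !gauss_kernel_shift gauss_kernel_diag subrr.
rewrite (gauss_kernelC x (l *: _ + x)) gauss_kernel_shift gauss_kernel_diag subrr.
rewrite !mul1r -expRD !mxE !eqxx !mulr0 !mul0r !add0r mulr1 !mulNr.
have -> : - (gamma * l ^+ 2) + (- (2 * gamma * (x 0 i - (l + x 0 i)) * h) - gamma * h ^+ 2) =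
  - (gamma * (h - l) ^+ 2) by ring.
ring.
Qed.

(** The difference quotients of the kernel sections are Cauchy in [H]. Pairing their limit with
    [k y] yields the derivative of the kernel, which identifies it as [dkernel x i]; pairing it with
    any [f] yields the reproducing property for derivatives. *)
Lemma dkernel_in x i : S (dkernel x i) /\ forall f df, S f ->
  is_derive (0 : R) 1 (fun h => f (h *: 'e_i + x)) df -> dot f (dkernel x i) = df.
Proof.
have [e e0|u Su uP] := hcomplete_weak hH (Skdq x i).
  (* With steps a and b at most 1, the squared distance of two quotients is at most 5 gamma^2 (a^2 +
     b^2) <= 5 gamma^2 (a + b), whence the 10. *)
  have [N _ NP] : \forall n \near \oo, n.+1%:R^-1 < e / (10 * gamma ^+ 2 + 1).
    have e' : 0 < e / (10 * gamma ^+ 2 + 1).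
      by rewrite divr_gt0// ltr_wpDl// mulr_ge0// sqr_ge0.
    exact: (near_infty_natSinv_lt (PosNum e')).
  have Ab a b : 2 * gamma * (1 - gamma * (a.+1%:R^-1 ^+ 2 + b.+1%:R^-1 ^+ 2)) <=
      dot (kdq x i a) (kdq x i b) <= 2 * gamma + gamma ^+ 2 * a.+1%:R^-1 * b.+1%:R^-1.
    have := @expR_diffquot_bounds _ gamma a.+1%:R^-1 b.+1%:R^-1 (ltW gamma0).
    rewrite !invr_ge0 !ler0n => /(_ isT isT).
    rewrite dot_kdq; set D := expR _ - _ - _ + _; set A := a.+1%:R; set B := b.+1%:R.
    have A0 : 0 < A by rewrite ltr0n.
    have B0 : 0 < B by rewrite ltr0n.
    have AB0 : 0 <= A * B by rewrite mulr_ge0// ltW.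
    move=> /andP[/(ler_wpM2l AB0) h1 /(ler_wpM2l AB0) h2]; apply/andP; split.
      by apply: le_trans h1; rewrite le_eqVlt; apply/orP; left; apply/eqP; field;
        rewrite !gt_eqF.
    by apply: (le_trans h2); rewrite le_eqVlt; apply/orP; left; apply/eqP; field;
      rewrite !gt_eqF.
  have G : 0 < 10 * gamma ^+ 2 + 1 by rewrite ltr_wpDl// mulr_ge0// sqr_ge0.
  have arith (A B C a b : R) : 0 <= a <= 1 -> 0 <= b <= 1 ->
      a < e / (10 * gamma ^+ 2 + 1) -> b < e / (10 * gamma ^+ 2 + 1) ->
      2 * gamma * (1 - gamma * (a ^+ 2 + b ^+ 2)) <= A ->
      B <= 2 * gamma + gamma ^+ 2 * a * a -> C <= 2 * gamma + gamma ^+ 2 * b * b ->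
      B - 2 * A + C < e.
    move=> /andP[a0 a1] /andP[b0 b1]; rewrite !(ltr_pdivlMr _ _ G) => ae be hA hB hC.
    have g2 := sqr_ge0 gamma.
    have : gamma ^+ 2 * a ^+ 2 <= gamma ^+ 2 * a by rewrite ler_wpM2l// expr2 ler_piMl.
    have : gamma ^+ 2 * b ^+ 2 <= gamma ^+ 2 * b by rewrite ler_wpM2l// expr2 ler_piMl.
    lra.
  have h01 p : 0 <= (p.+1%:R^-1 : R) <= 1 by rewrite invr_ge0 ler0n invf_le1 ?ler1n.
  exists N => m n Nm Nn; rewrite (hdot_sqB hH (Skdq x i m) (Skdq x i n)).
  have /andP[Amn _] := Ab m n; have /andP[_ Amm] := Ab m m; have /andP[_ Ann] := Ab n n.
  exact: (arith _ _ _ _ _ (h01 m) (h01 n) (NP _ Nm) (NP _ Nn) Amn Amm Ann).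
have lim f df : S f -> is_derive (0 : R) 1 (fun h => f (h *: 'e_i + x)) df ->
    dot u f = df.
  move=> Sf /cvg_diffquot fdf.
  rewrite -(cvg_lim (@Rhausdorff R) fdf) -(cvg_lim (@Rhausdorff R) (uP f Sf)).
  congr (limn _); apply/funext => n; rewrite (hdotZl hH)//; last exact: (hsetB hH).
  rewrite (hdotBl hH)// scale0r add0r.
  by rewrite (hdot_sym hH (Sk _) Sf) (hdot_sym hH (Sk x) Sf) !repro.
have -> : dkernel x i = u.
  apply/funext => y; rewrite -[RHS]repro//; apply/esym/lim => //.
  rewrite (_ : (fun h => _) = (fun h => k (h *: 'e_i + x) y)).
    exact: is_derive_kernel.
  by apply/funext => h; rewrite gauss_kernelC.
by split => // f df Sf fdf; rewrite (hdot_sym hH Sf Su); exact: lim.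
Qed.

Let xi x := stein_feature (@gaussian_density R d) k x.

Let comp_xi x i : (fun y => xi x y 0 i : R^o) = - x 0 i *: (k x : _ -> R^o) + dkernel x i.
Proof. by apply/funext => y; rewrite /xi stein_feature_gauss. Qed.

Lemma stein_feature_in x : hset (hpow H d) (xi x).
Proof.
move=> i; rewrite comp_xi; apply: (hset_lin hH) => //.
by have [] := dkernel_in x i.
Qed.

(** Pairing with [k y] evaluates and pairing with [dkernel y i] differentiates. For f the i-th entry
    of [xi x], the i-th term is therefore - y_i f(y) plus the i-th partial derivative of f at y. *)
Lemma hdot_stein_feature x y : hdot (hpow H d) (xi x) (xi y) = stein_kernel x y.
Proof.
rewrite /stein_kernel mulr_sumr; apply: eq_bigr => i _.
have Sxi := stein_feature_in x i; rewrite /= in Sxi.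
have [Sdk dkP] := dkernel_in y i.
rewrite [X in dot _ X]comp_xi (hdotDr hH (hsetZ hH _ (Sk y)) Sdk Sxi).
rewrite (hdotZr hH _ (Sk y) Sxi) (repro _ Sxi).
pose u := x 0 i - y 0 i.
pose D := k x y * (2 * gamma * u * (- x 0 i - 2 * gamma * u) + 2 * gamma).
suff dD : is_derive (0 : R) 1 (fun h => xi x (h *: 'e_i + y) 0 i) D.
  rewrite (dkP _ _ Sxi dD) /D.
  by rewrite /xi stein_feature_gauss /dkernel /u; ring.
have := is_derive_expR_quad 0 (2 * gamma * u) (- gamma)
  (k x y * (- x 0 i - 2 * gamma * u)) (k x y * (2 * gamma)) 0.
congr (is_derive (0 : R) (1 : R) _ _); last by rewrite expR0 /D; ring.
apply/funext => h; rewrite /xi stein_feature_gauss /dkernel !(gauss_kernelC x).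
rewrite gauss_kernel_shift !mxE !eqxx mulr1.
rewrite (_ : - 2 * gamma * (y 0 i - x 0 i) * h - gamma * h ^+ 2 =
  0 + 2 * gamma * u * h + - gamma * h ^+ 2); last by rewrite /u; ring.
by rewrite /u; ring.
Qed.

End rkhs.
End stein_kernel.

(** * The Stein covariance operator *)

Lemma cvg_sqr0 {R : realType} (a b : R^nat) : (forall n, a n ^+ 2 <= b n) ->
  b n @[n --> \oo] --> 0 -> a n @[n --> \oo] --> 0.
Proof.
move=> ab b0; apply: norm_cvg0.
apply: (@squeeze_cvgr _ _ _ _ (fun=> 0) (fun n => Num.sqrt (b n))).
- by apply: nearW => n; rewrite normr_ge0/= -sqrtr_sqr ler_wsqrtr.
- exact: cvg_cst.
- rewrite -[X in _ --> X]sqrtr0; apply: continuous_cvg => //.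
  exact: sqrt_continuous.
Qed.

(** The two limits force |u n - v|^2 to 0. When [u] runs through kernel sections or Stein features,
    they are limits of explicit functions, so continuity of the kernel transfers to all of the
    space. *)
Lemma hdot_cvg {R : realType} {V : lmodType R} (H : hspace V) (hH : is_hilbert H)
    (u : nat -> V) (v F : V) : (forall n, hset H (u n)) -> hset H v -> hset H F ->
  hdot H (u n) (u n) @[n --> \oo] --> hdot H v v ->
  hdot H (u n) v @[n --> \oo] --> hdot H v v ->
  hdot H (u n) F @[n --> \oo] --> hdot H F v.
Proof.
move=> Su Sv SF uu uv; rewrite (hdot_sym hH SF Sv); apply/subr_cvg0.
apply: (@cvg_sqr0 _ _ (fun n => hdot H (u n - v) (u n - v) * hdot H F F)).
  move=> n; rewrite -(hdotBl hH (Su n) Sv SF).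
  by apply: (cauchy_schwarz hH) => //; exact: (hsetB hH).
rewrite -[X in _ --> X](mul0r (hdot H F F)); apply: cvgMl.
have -> : 0 = hdot H v v - 2 * hdot H v v + hdot H v v by ring.
under eq_cvg do rewrite (hdot_sqB hH (Su _) Sv).
apply: cvgD; last exact: cvg_cst.
by apply: cvgB => //; apply: cvgMr.
Qed.

Lemma measurable_countable_comp d (T : measurableType d) (U : countType)
    (R : realType) (q : T -> U) (G : U -> R) :
  (forall u, measurable (q @^-1` [set u])) -> measurable_fun setT (G \o q).
Proof.
move=> mq _ Y mY; rewrite setTI.
rewrite (_ : _ @^-1` _ = \bigcup_u (if G u \in Y then q @^-1` [set u] else set0)).
  apply: countable_bigcupT_measurable; first exact: countableP.
  by move=> u; case: ifP.
apply/seteqP; split => [t /= Yt|t [u _]].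
  by exists (q t) => //; rewrite mem_set.
by case: ifPn => // /set_mem Yu /= ->.
Qed.

Section grid.
Context {R : realType} {d : nat}.
Implicit Types x : 'rV[R]_d.

(** The grid of mesh 1 / (n + 1) serves twice. Rounding a sample to it makes any function of the
    sample countably valued, hence measurable, and continuous pairings are limits of such functions.
    The union of all grids is a countable dense set, from which separability follows. *)
Definition grid_point n (z : 'rV[int]_d) : 'rV[R]_d :=
  \row_i ((z 0 i)%:~R / n.+1%:R).

Definition grid_index n x : 'rV[int]_d := \row_i Num.floor (n.+1%:R * x 0 i).

Lemma grid_cvg x i :
  grid_point n (grid_index n x) 0 i @[n --> \oo] --> x 0 i.
Proof.
apply/subr_cvg0; apply: norm_cvg0.
apply: (@squeeze_cvgr _ _ _ _ (fun=> 0) (fun n => n.+1%:R^-1)); last 2 first.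
- exact: cvg_cst.
- exact: cvg_harmonic.
apply: nearW => n; rewrite normr_ge0/= !mxE.
have n0 : 0 < n.+1%:R :> R by rewrite ltr0n.
have /andP[] := floor_itv (n.+1%:R * x 0 i); rewrite intrD.
set z := (Num.floor _)%:~R => h1 h2.
have -> : z / n.+1%:R - x 0 i = (z - n.+1%:R * x 0 i) / n.+1%:R.
  by field; rewrite gt_eqF.
rewrite normrM normfV (gtr0_norm n0) -[leRHS]mul1r ler_pM2r ?invr_gt0//.
by rewrite ler_norml; apply/andP; split; lra.
Qed.

Lemma measurable_grid (G : 'rV[R]_d -> R) n : measurable_fun setT
  (fun t : Rtuple R d => G (grid_point n (grid_index n (vec t)))).
Proof.
apply: (@measurable_countable_comp _ _ 'rV[int]_d R
  (fun t : Rtuple R d => grid_index n (vec t)) (G \o grid_point n)) => z.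
rewrite (_ : _ @^-1` _ = \bigcap_(i in [set: 'I_d])
  ((fun t : Rtuple R d => n.+1%:R * tnth t i) @^-1` `[(z 0 i)%:~R, (z 0 i + 1)%:~R[)).
  apply: fin_bigcap_measurable; first exact: finite_finset.
  move=> i _; rewrite -[X in measurable X]setTI.
  have mi : measurable_fun setT (fun t : Rtuple R d => n.+1%:R * tnth t i).
    by apply: measurable_funM => //; exact: (@measurable_tnth _ (measurableTypeR R)).
  by apply: mi => //; exact: measurable_itv.
apply/seteqP; split => t /=.
  by move=> <- i _; rewrite /= in_itv/= !mxE floor_itv.
move=> zt; apply/rowP => i; rewrite !mxE; apply/eqP; rewrite floor_eq.
by have := zt i I; rewrite /= in_itv.
Qed.

End grid.

Section stein_covariance.
Context {R : realType} (d : nat) (gamma : R).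
Hypothesis gamma0 : 0 < gamma.
Local Notation k := (@gauss_kernel R d gamma).
Variable H : hspace ('rV[R]_d -> R^o).
Hypothesis Hk : is_rkhs k H.
Let hH : is_hilbert H. Proof. by case: Hk. Qed.
Let hHd : is_hilbert (hpow H d). Proof. exact: hpow_is_hilbert. Qed.
Let Sk x : hset H (k x). Proof. by case: Hk. Qed.
Let repro f x : hset H f -> hdot H f (k x) = f x. Proof. by case: Hk => _ _; apply. Qed.
Local Notation xi := (stein_feature (@gaussian_density R d) k).
Let Sxi x : hset (hpow H d) (xi x). Proof. exact: stein_feature_in. Qed.

Let kernel_cvg (x y : nat -> 'rV[R]_d) (a b : 'rV[R]_d) :
  (forall i, x n 0 i @[n --> \oo] --> a 0 i) ->
  (forall i, y n 0 i @[n --> \oo] --> b 0 i) ->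
  k (x n) (y n) @[n --> \oo] --> k a b /\
  stein_kernel gamma (x n) (y n) @[n --> \oo] --> stein_kernel gamma a b.
Proof.
move=> xa yb.
have sub i : x n 0 i - y n 0 i @[n --> \oo] --> a 0 i - b 0 i by exact: cvgB.
have sqr i : (x n 0 i - y n 0 i) ^+ 2 @[n --> \oo] --> (a 0 i - b 0 i) ^+ 2.
  by rewrite expr2; under eq_cvg do rewrite expr2; exact: cvgM.
have kc : k (x n) (y n) @[n --> \oo] --> k a b.
  apply: (@cvg_comp _ _ _ (fun n => - gamma * sqnorm (x n - y n)) expR _ _ _ _ (@continuous_expR R _)).
  apply: cvgMr.
  rewrite /sqnorm; apply: cvg_sumr => i.
  by under eq_cvg do rewrite !mxE; rewrite !mxE; exact: sqr.
split=> //; apply: cvgM => //; apply: cvg_sumr => i.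
apply: cvgD; last exact: cvg_cst.
by apply: cvgB; [exact: cvgM|exact: cvgMr].
Qed.

Lemma stein_feature_cvg (x : nat -> 'rV[R]_d) (a : 'rV[R]_d) F :
  (forall i, x n 0 i @[n --> \oo] --> a 0 i) -> hset (hpow H d) F ->
  hdot (hpow H d) (xi (x n)) F @[n --> \oo] --> hdot (hpow H d) (xi a) F.
Proof.
move=> xa SF; rewrite (hdot_sym hHd (Sxi a) SF); apply: (hdot_cvg hHd) => //.
- by under eq_cvg do rewrite hdot_stein_feature//; rewrite hdot_stein_feature//;
    have [] := kernel_cvg xa xa.
- under eq_cvg do rewrite hdot_stein_feature//; rewrite hdot_stein_feature//.
  by have [] := kernel_cvg xa (fun i => cvg_cst (a 0 i)).
Qed.

Lemma rkhs_cvg (x : nat -> 'rV[R]_d) (a : 'rV[R]_d) (f : 'rV[R]_d -> R^o) :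
  (forall i, x n 0 i @[n --> \oo] --> a 0 i) -> hset H f ->
  f (x n) @[n --> \oo] --> f a.
Proof.
move=> xa Sf; rewrite -(repro a Sf).
rewrite (_ : (fun n => f (x n)) = fun n => hdot H (k (x n)) f); last first.
  by apply/funext => n; rewrite (hdot_sym hH (Sk _) Sf) repro.
apply: (hdot_cvg hH) => //.
- under eq_cvg do rewrite repro//.
  by rewrite repro//; have [] := kernel_cvg xa xa.
- under eq_cvg do rewrite repro//.
  by rewrite repro//; have [] := kernel_cvg xa (fun i => cvg_cst (a 0 i)).
Qed.

Lemma measurable_stein_feature F : hset (hpow H d) F ->
  measurable_fun setT (fun t : Rtuple R d => hdot (hpow H d) (xi (vec t)) F).
Proof.
move=> SF.
apply: (measurable_fun_cvg (fun n => measurable_grid (fun x => hdot (hpow H d) (xi x) F) n)).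
move=> t _; apply: stein_feature_cvg => // i; exact: grid_cvg.
Qed.

(** Separability: members of [H] are continuous by [rkhs_cvg], so one that vanishes at every grid
    point is zero. Each [j] decodes to a grid, a point and a coordinate; codes of nothing give the
    vector 0. *)
Lemma countable_hpow_basis E : orthonormal_basis (hpow H d) E -> countable E.
Proof.
case=> ES E1 E0 _.
pose v j : 'rV[R]_d -> 'rV[R]_d :=
  if unpickle j is Some (n, z, i) then
    fun y => k (grid_point n z) y *: delta_mx 0 (i : 'I_d)
  else 0.
apply: (countable_orthonormal hHd (v := v)) => //.
  move=> j; rewrite /v; case: unpickle => [[[n z] i]|]; last exact: hset0.
  by apply: hset_delta => //.
move=> u Su u0; apply/funext => x; apply/rowP => i; rewrite [RHS]mxE.
have Sui : hset H (fun x => u x 0 i) by exact: Su.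
have ux := rkhs_cvg (fun j => @grid_cvg R d x j) Sui.
rewrite -(cvg_lim (@Rhausdorff R) ux).
apply: lim_near_cst => //; apply: nearW => n.
have := u0 (pickle (n, grid_index n x, i)); rewrite /v pickleK.
by rewrite hpow_dot_delta// repro.
Qed.

Section operator.
Variable E : set ('rV[R]_d -> 'rV[R]_d).
Hypothesis hE : orthonormal_basis (hpow H d) E.
Hypothesis int_diag : (std_gaussian d).-integrable setT
  (EFin \o (fun t : Rtuple R d => stein_kernel gamma (vec t) (vec t))).
Local Notation T := (gauss_stein_cov gamma H).
Local Notation P := (std_gaussian d).

Let int_xi : P.-integrable setT
  (EFin \o (fun t : Rtuple R d => hdot (hpow H d) (xi (vec t)) (xi (vec t)))).
Proof.
apply: eq_integrable int_diag => // t _; congr EFin.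
exact/esym/(hdot_stein_feature gamma0 Hk).
Qed.

(** The Riesz representer [w] lies in H^d by construction; paired with a kernel section placed in
    coordinate [i], it has the same entries as the entrywise integral [T F]. *)
Let TE F : hset (hpow H d) F -> hset (hpow H d) (T F) /\
  forall G, hset (hpow H d) G -> hdot (hpow H d) (T F) G =
    \int[P]_t (hdot (hpow H d) (xi (vec t)) F * hdot (hpow H d) (xi (vec t)) G).
Proof.
move=> SF.
have [w Sw wE] := covariance_representer hHd (fun t => Sxi (vec t))
  measurable_stein_feature int_xi SF.
suff -> : T F = w by [].
apply/funext => y; apply/rowP => i; rewrite [LHS]mxE.
have Swi j : hset H (fun x => w x 0 j) by exact: Sw.
rewrite -(repro y (Swi i)) -hpow_dot_delta// wE; last exact: hset_delta.
apply: eq_Rintegral => t _; rewrite hpow_dot_delta// repro; last exact: Sxi.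
by rewrite /tensor /= mxE.
Qed.

Lemma trace_stein_cov : trace (hpow H d) E T =
  \int[P]_t stein_kernel gamma (vec t) (vec t).
Proof.
rewrite (trace_covariance hHd (fun t => Sxi (vec t)) measurable_stein_feature int_xi
  (fun F SF => (TE SF).1) (fun F G SF => (TE SF).2 G) hE (countable_hpow_basis hE)).
by apply: eq_Rintegral => t _; rewrite hdot_stein_feature.
Qed.

Lemma trace_stein_cov_sqr : trace (hpow H d) E (T \o T) =
  \int[P]_s \int[P]_t (stein_kernel gamma (vec s) (vec t) ^+ 2).
Proof.
rewrite (trace_covariance_sqr hHd (fun t => Sxi (vec t)) measurable_stein_feature int_xi
  (fun F SF => (TE SF).1) (fun F G SF => (TE SF).2 G) hE (countable_hpow_basis hE)).
by apply: eq_Rintegral => s _; apply: eq_Rintegral => t _; rewrite hdot_stein_feature.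
Qed.

End operator.
End stein_covariance.

(** * Gaussian integrals *)

Section integral_derivative.
Context {R : realType}.
Notation mu := (@lebesgue_measure R).

(** The fundamental theorem of calculus on [-n, n], then dominated convergence with bound |f|. *)
Lemma integral_derivative0 (F f : R -> R) : (forall x : R, is_derive x (1 : R) F (f x)) ->
  continuous f -> mu.-integrable setT (EFin \o f) ->
  F n%:R @[n --> \oo] --> 0 -> F (- n%:R) @[n --> \oo] --> 0 ->
  (\int[mu]_x (f x)%:E = 0)%E.
Proof.
move=> dF cf fi Fy FNy.
have cF x : {for x, continuous F}.
  by apply/differentiable_continuous/derivable1_diffP; case: (dF x).
pose D n := [set` `[- n%:R, n%:R]] : set R.
(* The shift to [n.+1] keeps the interval nondegenerate, as the fundamental theorem requires. *)
have ftc n : (\int[mu]_x (f \_ (D n.+1) x)%:E = (F n.+1%:R - F (- n.+1%:R))%:E)%E.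
  rewrite (_ : (fun x => _) = (EFin \o f) \_ (D n.+1)); last first.
    by apply/funext => x; rewrite restrict_EFin.
  rewrite -integral_mkcond/= (continuous_FTC2 (F := F)) ?EFinB//.
  - by rewrite gtrN// ltr0n.
  - exact: continuous_subspaceT.
  - split; first by move=> x _; case: (dF x).
      by apply: cvg_at_right_filter; exact: cF.
    by apply: cvg_at_left_filter; exact: cF.
  - by move=> x _; rewrite derive1E; case: (dF x).
have mf : measurable_fun setT f by exact: continuous_measurable_fun.
have mD n : measurable (D n) by exact: measurable_itv.
have ae1 : {ae mu, forall x, setT x ->
    (fun n => (f \_ (D n.+1) x)%:E) @ \oo --> (f x)%:E}.
  apply/aeW => x _; apply: cvg_near_cst.
  exists (Num.bound x) => // n /= xn; rewrite patchE mem_set// /D/= in_itv/=.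
  have xb := unstable.ltr_norm_bound x; rewrite -ler_norml (le_trans (ltW xb))// ler_nat.
  exact: leqW.
have ae2 : {ae mu, forall x n, setT x -> (`|(f \_ (D n.+1) x)%:E| <= (`|f x|)%:E)%E}.
  by apply/aeW => x n _; rewrite lee_fin patchE; case: ifPn; rewrite ?normr0.
have [|||_ _ lim_int] := @dominated_convergence _ _ _ mu setT measurableT
  (fun n x => (f \_ (D n.+1) x)%:E) (fun x => (f x)%:E) (fun x => (`|f x|)%:E) _ _ ae1 _ ae2.
- move=> n; apply/measurable_EFinP; apply/(measurable_restrictT _ (mD _)).
  exact: measurable_funTS.
- exact/measurable_EFinP.
- exact: integrable_norm.
have F0 : (fun n => (F n.+1%:R - F (- n.+1%:R))%:E) @ \oo --> (0%:E : \bar R).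
  apply: cvg_EFin; first exact: nearW.
  rewrite -[X in _ --> X](subrr (0 : R)).
  by apply: (@cvgB _ R^o nat _ _ (fun n => F n.+1%:R) (fun n => F (- n.+1%:R)));
    rewrite (cvg_shiftS (fun n => F _)).
rewrite -(cvg_lim _ lim_int)//; apply: etrans (cvg_lim _ F0) => //.
by congr (limn _); apply/funext => n; rewrite -ftc.
Qed.

End integral_derivative.

Section gaussian_moments.
Context {R : realType}.
Notation mu := (@lebesgue_measure R).
Implicit Types (t m x : R).

(** An unnormalised Gaussian parametrised by its precision [t], since precisions add when bumps are
    multiplied. *)
Definition gauss_bump t m x : R := expR (- (t / 2) * (x - m) ^+ 2).

Definition quartic (c0 c1 c2 c3 c4 u : R) : R :=
  c0 + c1 * u + c2 * u ^+ 2 + c3 * u ^+ 3 + c4 * u ^+ 4.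

Lemma gauss_bump_ge0 t m x : 0 <= gauss_bump t m x.
Proof. exact: expR_ge0. Qed.

Lemma gauss_bumpE t m x : 0 < t ->
  gauss_bump t m x = Num.sqrt (2 * pi / t) * normal_pdf m (Num.sqrt t)^-1 x.
Proof.
move=> t0; have st0 : 0 < Num.sqrt t by rewrite sqrtr_gt0.
rewrite normal_pdfE ?invr_eq0 ?gt_eqF// /normal_peak /normal_fun.
rewrite exprVn sqr_sqrtr ?ltW// mulrA.
rewrite (_ : t^-1 * pi *+ 2 = 2 * pi / t); last by rewrite -mulr_natr; ring.
rewrite mulfV ?mul1r; last first.
  by rewrite gt_eqF// sqrtr_gt0 divr_gt0// mulr_gt0// pi_gt0.
by congr expR; rewrite -mulr_natr; field; rewrite gt_eqF.
Qed.

Lemma integrable_gauss_bump t m : 0 < t ->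
  mu.-integrable setT (EFin \o gauss_bump t m).
Proof.
move=> t0; rewrite (_ : gauss_bump t m = fun x => Num.sqrt (2 * pi / t) * normal_pdf m (Num.sqrt t)^-1 x).
  apply: integrableZl_fin; exact: integrable_normal_pdf.
by apply/funext => x; exact: gauss_bumpE.
Qed.

Lemma integral_gauss_bump t m : 0 < t ->
  \int[mu]_x gauss_bump t m x = Num.sqrt (2 * pi / t).
Proof.
move=> t0; under eq_Rintegral do rewrite gauss_bumpE//.
rewrite RintegralZl//; last exact: integrable_normal_pdf.
by rewrite /Rintegral integral_normal_pdf mulr1.
Qed.

Lemma is_derive_gauss_bump t m x :
  is_derive x (1 : R) (gauss_bump t m) (- t * (x - m) * gauss_bump t m x).
Proof.
have dq : is_derive x (1 : R) (fun x => - (t / 2) * (x - m) ^+ 2) (- t * (x - m)).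
  rewrite (_ : (fun x => _) = - (t / 2) *: (id - cst m) ^+ 2); last first.
    by apply/funext => y; rewrite !fctE.
  by apply: is_derive_eq; rewrite !fctE /= expr1 subr0 /GRing.scale/=; field.
rewrite mulrC; exact: (is_derive1_comp (is_derive_expR _) dq).
Qed.

Lemma is_derive_cubic (a1 a2 a3 a4 m x : R) :
  is_derive x (1 : R) (fun x => quartic a1 a2 a3 a4 0 (x - m))
    (quartic a2 (2 * a3) (3 * a4) 0 0 (x - m)).
Proof.
pose u : R -> R := id - cst m.
have du : is_derive x (1 : R) u 1.
  by apply: is_derive_eq; rewrite subr0.
rewrite (_ : (fun x => _) = cst a1 + a2 *: u + a3 *: u ^+ 2 + a4 *: u ^+ 3); last first.
  by apply/funext => y; rewrite !fctE /quartic mul0r addr0.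
have [D1 D2] := is_deriveD (is_deriveD (is_deriveD (is_derive_cst a1 x (1 : R))
  (is_deriveZ a2 du)) (is_deriveZ a3 (is_deriveX 2 du))) (is_deriveZ a4 (is_deriveX 3 du)).
apply: DeriveDef; first exact: D1.
rewrite [LHS]D2 /u !fctE /= expr1 /quartic /GRing.scale/=; ring.
Qed.

Lemma continuous_quartic (c0 c1 c2 c3 c4 m : R) :
  continuous (fun x : R => quartic c0 c1 c2 c3 c4 (x - m)).
Proof.
move=> x; have cu : {for x, continuous (fun x : R => x - m)}.
  by apply: cvgB; [exact: cvg_id|exact: cvg_cst].
have cX n : {for x, continuous (fun x : R => (x - m) ^+ n)}.
  apply: (@cvg_comp _ _ _ (fun x : R => x - m) (fun y : R => y ^+ n) _ _ _ cu).
  exact: exprn_continuous.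
rewrite /quartic; repeat (apply: cvgD); try exact: cvg_cst;
  by apply: cvgMr; first [exact: cu | exact: cX].
Qed.

(** Half of the exponent pays for the power: with y = t u^2 / 4, exp y >= y^2 / 2 gives u^4 exp (-
    y) <= 32 / t^2. *)
Lemma pow4_gauss_bump t m x : 0 < t ->
  (x - m) ^+ 4 * gauss_bump t m x <= 32 / t ^+ 2 * gauss_bump (t / 2) m x.
Proof.
move=> t0; rewrite /gauss_bump; set u := x - m.
have -> : - (t / 2) * u ^+ 2 = - (t / 2 / 2) * u ^+ 2 + - (t / 4 * u ^+ 2) by field.
rewrite expRD mulrCA [leRHS]mulrC ler_wpM2l ?expR_ge0// expRN ler_pdivrMr ?expR_gt0//.
have y0 : 0 <= t / 4 * u ^+ 2 by rewrite mulr_ge0 ?sqr_ge0// divr_ge0// ltW.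
have : 1 + (t / 4 * u ^+ 2) ^+ 2 / 2 <= expR (t / 4 * u ^+ 2) by exact: (expR_ge1Dxn 1).
set e := expR _ => he; rewrite mulrAC ler_pdivlMr ?exprn_gt0//.
have : u ^+ 4 * t ^+ 2 = 32 * ((t / 4 * u ^+ 2) ^+ 2 / 2) by field.
by move: he; lra.
Qed.

Lemma quartic_le (c0 c1 c2 c3 c4 u : R) : `|quartic c0 c1 c2 c3 c4 u| <=
  (`|c0| + `|c1| + `|c2| + `|c3| + `|c4|) * (1 + u ^+ 4).
Proof.
have u0 := normr_ge0 u.
have u2 : `|u| ^+ 2 <= 1 + `|u| ^+ 4 by have := sqr_ge0 (`|u| ^+ 2 - 1); nra.
have u1 : `|u| <= 1 + `|u| ^+ 4 by have := sqr_ge0 (`|u| - 1); nra.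
have u3 : `|u| ^+ 3 <= 1 + `|u| ^+ 4.
  have := sqr_ge0 (`|u| ^+ 2 - `|u|); have := sqr_ge0 (`|u| ^+ 2 - 1); nra.
have u4 : 0 <= `|u| ^+ 4 by exact: exprn_ge0.
have -> : u ^+ 4 = `|u| ^+ 4 by rewrite -normrX ger0_norm// exprn_even_ge0.
have H c w : `|w| <= 1 + `|u| ^+ 4 -> `|c * w| <= `|c| * (1 + `|u| ^+ 4).
  by move=> w1; rewrite normrM ler_wpM2l.
rewrite /quartic ![in leRHS]mulrDl.
apply: (le_trans (ler_normD _ _)); apply: lerD; last first.
  by apply: H; rewrite normrX lerDr.
apply: (le_trans (ler_normD _ _)); apply: lerD; last by apply: H; rewrite normrX.
apply: (le_trans (ler_normD _ _)); apply: lerD; last by apply: H; rewrite normrX.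
apply: (le_trans (ler_normD _ _)); apply: lerD; last exact: H.
by rewrite -[X in `|X| <= _]mulr1; apply: H; rewrite normr1 lerDl.
Qed.

Lemma quartic_bump_le t m (c0 c1 c2 c3 c4 x : R) : 0 < t ->
  `|quartic c0 c1 c2 c3 c4 (x - m) * gauss_bump t m x| <=
  (`|c0| + `|c1| + `|c2| + `|c3| + `|c4|) *
  (gauss_bump t m x + 32 / t ^+ 2 * gauss_bump (t / 2) m x).
Proof.
move=> t0; rewrite normrM (ger0_norm (gauss_bump_ge0 _ _ _)).
apply: (le_trans (ler_wpM2r (gauss_bump_ge0 _ _ _) (quartic_le _ _ _ _ _ _))).
rewrite -[leLHS]mulrA; apply: ler_wpM2l; first by rewrite !addr_ge0.
by rewrite mulrDl mul1r lerD2l pow4_gauss_bump.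
Qed.

Lemma integrable_quartic t m (c0 c1 c2 c3 c4 : R) : 0 < t ->
  mu.-integrable setT
    (EFin \o (fun x => quartic c0 c1 c2 c3 c4 (x - m) * gauss_bump t m x)).
Proof.
move=> t0; set C := `|c0| + `|c1| + `|c2| + `|c3| + `|c4|.
apply: (@ler_integrable _ _ _ mu _ (fun x => C * (gauss_bump t m x +
  32 / t ^+ 2 * gauss_bump (t / 2) m x))).
- apply: measurable_funM; last first.
    by have /measurable_int/measurable_EFinP := integrable_gauss_bump m t0.
  by apply: continuous_measurable_fun; exact: continuous_quartic.
- by move=> x; exact: quartic_bump_le.
- apply: integrableZl_fin.
  apply: integrableD_fin; first exact: integrable_gauss_bump.
  by apply: integrableZl_fin; apply: integrable_gauss_bump; rewrite divr_gt0.
Qed.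

(** The condition on [v] covers both ends n and - n. Once n >= 2 |m| + 1, |v n - m| >= (n + 1) / 2,
    so the exponent is at least t (n + 1) / 8, and exp (- y) <= 1 / y. *)
Lemma gauss_bump_cvg0 t m (v : R^nat) : 0 < t -> (forall n, `|v n| = n%:R) ->
  gauss_bump t m (v n) @[n --> \oo] --> 0.
Proof.
move=> t0 vn; apply: (@squeeze_cvgr _ _ _ _ (fun=> 0) (fun n => 8 / t * n.+1%:R^-1)).
- exists (Num.bound (2 * `|m| + 1)) => // n /= mn; rewrite gauss_bump_ge0/=.
  have {mn} mn : 2 * `|m| + 1 <= n%:R.
    by rewrite (le_trans (ltW (archi_boundP _)))// ler_nat.
  set y := t / 2 * (v n - m) ^+ 2.
  have vm : n.+1%:R / 2 <= `|v n - m|.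
    have arith (N a b : R) : 2 * a + 1 <= N -> N - a <= b -> (N + 1) / 2 <= b by lra.
    by have := lerB_dist (v n) m; rewrite vn -natr1; exact: arith.
  have yn : t / 8 * n.+1%:R <= y.
    rewrite /y -(real_normK (num_real (v n - m))).
    have n1 : 1 <= n.+1%:R :> R by rewrite ler1n.
    have : (n.+1%:R / 2) ^+ 2 <= `|v n - m| ^+ 2 by rewrite ler_pXn2r// nnegrE.
    have arith (N V : R) : 1 <= N -> (N / 2) ^+ 2 <= V -> t / 8 * N <= t / 2 * V.
      move=> N1 NV; have {NV} : N / 4 <= V by nra.
      by move/(ler_wpM2l (ltW t0)); lra.
    exact: arith.
  have ty : 0 < t / 8 * n.+1%:R by rewrite mulr_gt0// divr_gt0.
  rewrite /gauss_bump mulNr expRN -/y.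
  rewrite (_ : 8 / t / n.+1%:R = (t / 8 * n.+1%:R)^-1); last first.
    by rewrite !invfM invrK [8 / t]mulrC.
  rewrite lef_pV2 ?posrE ?expR_gt0//; apply: (le_trans yn).
  by have := expR_ge1Dx y; lra.
- exact: cvg_cst.
- by rewrite -[X in _ --> X](mulr0 (8 / t)); apply: cvgMr; exact: cvg_harmonic.
Qed.

Lemma quartic_bump_cvg0 t m (c0 c1 c2 c3 c4 : R) (v : R^nat) : 0 < t ->
  (forall n, `|v n| = n%:R) ->
  quartic c0 c1 c2 c3 c4 (v n - m) * gauss_bump t m (v n) @[n --> \oo] --> 0.
Proof.
move=> t0 vn; set C := `|c0| + `|c1| + `|c2| + `|c3| + `|c4|.
apply: norm_cvg0; apply: (@squeeze_cvgr _ _ _ _ (fun=> 0) (fun n =>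
  C * (gauss_bump t m (v n) + 32 / t ^+ 2 * gauss_bump (t / 2) m (v n)))).
- apply: nearW => n; rewrite normr_ge0/=; exact: quartic_bump_le.
- exact: cvg_cst.
- rewrite (_ : 0 = C * (0 + 32 / t ^+ 2 * 0)); last by rewrite mulr0 addr0 mulr0.
  apply: cvgMr; apply: cvgD; first exact: gauss_bump_cvg0.
  by apply: cvgMr; apply: gauss_bump_cvg0; rewrite ?divr_gt0.
Qed.

(** Up to a multiple of the bump itself, the integrand is the derivative of a cubic times the bump.
    Comparing coefficients from degree 4 downwards gives the cubic with coefficients [a1], [a2],
    [- c3 / t], [- c4 / t], and leaves [c0 + b] times the bump. *)
Lemma gauss_moments t m (c0 c1 c2 c3 c4 : R) : 0 < t ->
  \int[mu]_x (quartic c0 c1 c2 c3 c4 (x - m) * gauss_bump t m x) =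
  Num.sqrt (2 * pi / t) * (c0 + c2 / t + 3 * c4 / t ^+ 2).
Proof.
move=> t0.
pose b := c2 / t + 3 * c4 / t ^+ 2.
pose f x := quartic (- b) c1 c2 c3 c4 (x - m) * gauss_bump t m x.
pose a1 := - (c1 + 2 * c3 / t) / t.
pose a2 := - (c2 + 3 * c4 / t) / t.
pose F x := quartic a1 a2 (- c3 / t) (- c4 / t) 0 (x - m) * gauss_bump t m x.
have fi : mu.-integrable setT (EFin \o f) by exact: integrable_quartic.
have dF x : is_derive x (1 : R) F (f x).
  have [D1 D2] := is_deriveM (is_derive_cubic a1 a2 (- c3 / t) (- c4 / t) m x)
    (is_derive_gauss_bump t m x).
  apply: DeriveDef; first exact: D1.
  rewrite [LHS]D2 /f /quartic /a1 /a2 /b /GRing.scale/=; field.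
  by rewrite gt_eqF.
have f0 : \int[mu]_x f x = 0.
  rewrite /Rintegral (integral_derivative0 dF)//.
  - move=> x; apply: cvgM; first exact: continuous_quartic.
    have [/derivable1_diffP/differentiable_continuous cg _] := is_derive_gauss_bump t m x.
    exact: cg.
  - by apply: quartic_bump_cvg0 => // n; rewrite ger0_norm.
  - by apply: quartic_bump_cvg0 => // n; rewrite normrN ger0_norm.
have ib : mu.-integrable setT (EFin \o (fun x => (c0 + b) * gauss_bump t m x)).
  by apply: integrableZl_fin; exact: integrable_gauss_bump.
transitivity (\int[mu]_x (f x + (c0 + b) * gauss_bump t m x)).
  by apply: eq_Rintegral => x _; rewrite /f /quartic; ring.
rewrite RintegralD// f0 add0r RintegralZl//; last exact: integrable_gauss_bump.
by rewrite integral_gauss_bump// mulrC /b addrA.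
Qed.

End gaussian_moments.

(** * Integration against densities and over product measures *)

Section density.
Context d (T : measurableType d) (R : realType).
Variables (nu : {finite_measure set T -> \bar R}) (mu : {sigma_finite_measure set T -> \bar R}).
Variable g : T -> R.
Hypothesis g0 : forall x, 0 <= g x.
Hypothesis gi : mu.-integrable setT (EFin \o g).
Hypothesis nuE : forall A, measurable A -> nu A = (\int[mu]_(x in A) (g x)%:E)%E.
Import Radon_Nikodym_SigmaFinite.

Let mg : measurable_fun setT g.
Proof. exact/measurable_EFinP/(measurable_int _ gi). Qed.

Let numu : nu `<< mu.
Proof.
apply/null_content_dominatesP => A mA A0; rewrite nuE//.
by apply: null_set_integral => //; apply: measurable_funTS; exact/measurable_EFinP.
Qed.

(** [g] and the Radon-Nikodym derivative of [nu] have equal integrals over all measurable sets, so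
    they agree almost everywhere. *)
Lemma ge0_integral_density (f : T -> \bar R) : (forall x, 0 <= f x)%E ->
  measurable_fun setT f -> (\int[nu]_x f x = \int[mu]_x (f x * (g x)%:E))%E.
Proof.
move=> f0 mf; rewrite -(change_of_variables numu)//.
have fi := f_integrable numu.
apply: ae_eq_integral => //.
- by apply: emeasurable_funM => //; exact: measurable_int fi.
- by apply: emeasurable_funM => //; exact/measurable_EFinP.
apply: ae_eqe_mul2l; apply: integral_ae_eq => //; first exact/measurable_EFinP.
by move=> A _ mA; rewrite -f_integral// nuE.
Qed.

Lemma integral_density (f : T -> R) : measurable_fun setT f ->
  mu.-integrable setT (EFin \o (fun x => f x * g x)) ->
  nu.-integrable setT (EFin \o f) /\ \int[nu]_x f x = \int[mu]_x (f x * g x).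
Proof.
move=> mf fgi; split.
  apply/integrableP; split; first exact/measurable_EFinP.
  rewrite ge0_integral_density//; last by apply: measurableT_comp => //; exact/measurable_EFinP.
  have /integrableP[_] := fgi; apply: le_lt_trans; apply: ge0_le_integral => //=.
  - by move=> x _; rewrite -EFinM lee_fin mulr_ge0.
  - apply: emeasurable_funM; last exact/measurable_EFinP.
    by apply/measurable_EFinP; exact: measurableT_comp.
  - by apply/measurable_EFinP; apply: measurableT_comp => //; exact: measurable_funM.
  - by move=> x _; rewrite -EFinM lee_fin normrM (ger0_norm (g0 x)).
rewrite /Rintegral [in LHS]integralE [in RHS]integralE; congr (fine (_ - _)%E).
- rewrite ge0_integral_density//; last by apply: measurable_funepos; exact/measurable_EFinP.
  apply: eq_integral => x _; rewrite !funeposE -EFin_max -EFinM -EFin_max.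
  by rewrite maxr_pMl// mul0r.
- rewrite ge0_integral_density//; last by apply: measurable_funeneg; exact/measurable_EFinP.
  apply: eq_integral => x _; rewrite !funenegE -!EFinN -!EFin_max -EFinM.
  by rewrite maxr_pMl// mul0r mulNr.
Qed.

End density.

Section power_measure_integral.
Context dT {T : measurableType dT} {R : realType}.
Variable m : {sigma_finite_measure set T -> \bar R}.

(** Independence of the coordinates: each step pulls the integral back along [tcons] and splits off
    the first factor by Fubini. *)
Lemma integral_power_measure_prod d (f : 'I_d -> T -> R) :
  (forall i, m.-integrable setT (EFin \o f i)) ->
  (power_measure m d).-integrable setT
    (EFin \o (fun t : d.-tuple T => \prod_i f i (tnth t i))) /\
  \int[power_measure m d]_t (\prod_i f i (tnth t i)) = \prod_i \int[m]_x f i x.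
Proof.
elim: d f => [|d IH] f fi.
  have E : (fun t : 0.-tuple T => \prod_i f i (tnth t i)) = cst 1.
    by apply/funext => t; rewrite big_ord0.
  rewrite E big_ord0; split.
    apply/integrableP; split => [|/=]; first exact/measurable_EFinP.
    by rewrite [ltLHS]integral_dirac// diracT mul1e normr1 ltry.
  rewrite Rintegral_cst// mul1r.
  have dT1 := diracT R ([tuple] : 0.-tuple T).
  by rewrite [X in fine X]dT1.
pose mu := power_measure m d.
pose G (t : d.-tuple T) := \prod_i f (lift ord0 i) (tnth t i).
have [Gi GE] := IH (fun i => f (lift ord0 i)) (fun i => fi _).
pose g (p : T * d.-tuple T) := f ord0 p.1 * G p.2.
have gE p : \prod_i f i (tnth (tcons p) i) = g p.
  rewrite big_ord_recl /g; congr (_ * _); apply: eq_bigr => i _.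
  by rewrite tnthS.
have mf i : measurable_fun setT (f i) by have /measurable_int/measurable_EFinP := fi i.
have mG : measurable_fun setT G by have /measurable_int/measurable_EFinP := Gi.
have mg : measurable_fun setT g.
  apply: measurable_funM; first exact: (measurableT_comp (mf ord0) measurable_fst).
  exact: (measurableT_comp mG measurable_snd).
have absGi := integrable_norm Gi; have absfi := integrable_norm (fi ord0).
have gi : (m \x mu)%E.-integrable setT (EFin \o g).
  apply/integrable12ltyP; first exact/measurable_EFinP.
  rewrite (_ : (fun x => _) = fun x => (`|f ord0 x| * \int[mu]_t `|G t|)%:E).
    have := integrable_lty measurableT (integrableZl_fin (\int[mu]_t `|G t|) absfi).
    by under eq_integral do rewrite /= mulrC.
  apply/funext => x /=; rewrite -RintegralZl// EFin_Rintegral; last exact: integrableZl_fin.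
  by apply: eq_integral => t _ /=; rewrite normrM.
have mprod : measurable_fun setT (fun t : d.+1.-tuple T => \prod_i f i (tnth t i)).
  apply: measurable_prod => i _; apply: measurableT_comp => //.
  exact: measurable_tnth.
have gi' : (m \x mu)%E.-integrable setT
    ((EFin \o (fun t : d.+1.-tuple T => \prod_i f i (tnth t i))) \o @tcons _ T d).
  by apply: eq_integrable gi => // p _ /=; rewrite gE.
split.
  apply: (integrable_pushforward (@measurable_tcons _ T d)) => //.
  exact/measurable_EFinP.
rewrite /Rintegral.
rewrite [X in fine X](integral_pushforward (@measurable_tcons _ T d))//; last exact/measurable_EFinP.
rewrite preimage_setT (_ : (fun x => _) = EFin \o g); last first.
  by apply/funext => p /=; rewrite gE.
rewrite -(integral12_prod_meas1 gi) big_ord_recl -GE.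
rewrite -RintegralZr// /Rintegral; congr fine; apply: eq_integral => x _.
rewrite /fubini_F/= -EFin_Rintegral; last exact: (integrableZl_fin (f ord0 x) Gi).
by congr EFin; exact: (@RintegralZl _ _ _ mu setT G (f ord0 x) measurableT Gi).
Qed.

End power_measure_integral.

Lemma std_gaussian_prod {R : realType} d (f : 'I_d -> R -> R) :
  (forall i, measurable_fun setT (f i)) ->
  (forall i, (@lebesgue_measure R).-integrable setT
    (EFin \o (fun x => f i x * normal_pdf 0 1 x))) ->
  (std_gaussian d).-integrable setT
    (EFin \o (fun t : Rtuple R d => \prod_i f i (tnth t i))) /\
  \int[std_gaussian d]_t (\prod_i f i (tnth t i)) =
  \prod_i \int[lebesgue_measure]_x (f i x * normal_pdf 0 1 x).
Proof.
move=> mf fi; have [Fi FE] := integral_power_measure_prod fi.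
have E (t : Rtuple R d) : \prod_i (f i (tnth t i) * normal_pdf 0 1 (tnth t i)) =
    (\prod_i f i (tnth t i)) * gaussian_density (vec t).
  by rewrite big_split/= gaussian_density_prod.
have mprod : measurable_fun setT (fun t : Rtuple R d => \prod_i f i (tnth t i)).
  apply: measurable_prod => i _.
  exact: (measurableT_comp (mf i) (@measurable_tnth _ (measurableTypeR R) d i)).
have gi : (lebesgue_tuple d).-integrable setT
    (EFin \o (fun t : Rtuple R d => gaussian_density (vec t))).
  apply/integrableP; split; first by apply/measurable_EFinP; exact: measurable_gaussian_density.
  under eq_integral do rewrite /= ger0_norm ?gaussian_density_ge0//.
  by rewrite integral_gaussian_density ltry.
have [|H1 H2] := @integral_density _ _ _ (std_gaussian d) (lebesgue_tuple d)
  (fun t : Rtuple R d => gaussian_density (vec t))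
  (fun t => gaussian_density_ge0 (vec t)) gi (fun A mA => erefl) _ mprod.
  by apply: eq_integrable Fi => // t _ /=; rewrite E.
split => //; rewrite H2 -FE.
by apply: eq_Rintegral => t _; rewrite E.
Qed.

(** * Closed forms of the two trace integrals *)

Section gaussian_traces.
Context {R : realType}.
Notation mu := (@lebesgue_measure R).

Lemma normal_pdf01E (x : R) :
  normal_pdf 0 1 x = (Num.sqrt (2 * pi))^-1 * gauss_bump 1 0 x.
Proof.
rewrite gauss_bumpE// sqrtr1 invr1 mulr1 mulrA mulVf ?mul1r//.
by rewrite gt_eqF// sqrtr_gt0 mulr_gt0// pi_gt0.
Qed.

(** The hypothesis on [f] is a completed square: a Gaussian factor of [f] merges with the standard
    bump into one of precision [t] centred at [m]. The inverse square root of [t] is the ratio of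
    the normalising constants. *)
Lemma normal_expectation (f : R -> R) (C t m c0 c1 c2 c3 c4 : R) : 0 < t ->
  (forall x, f x * gauss_bump 1 0 x =
     C * (quartic c0 c1 c2 c3 c4 (x - m) * gauss_bump t m x)) ->
  mu.-integrable setT (EFin \o (fun x => f x * normal_pdf 0 1 x)) /\
  \int[mu]_x (f x * normal_pdf 0 1 x) =
    C * (Num.sqrt t)^-1 * (c0 + c2 / t + 3 * c4 / t ^+ 2).
Proof.
move=> t0 fE; have pi2 : 0 < 2 * pi :> R by rewrite mulr_gt0// pi_gt0.
have s2 : Num.sqrt (2 * pi) != 0 :> R by rewrite gt_eqF// sqrtr_gt0.
have E x : f x * normal_pdf 0 1 x = (Num.sqrt (2 * pi))^-1 * C *
    (quartic c0 c1 c2 c3 c4 (x - m) * gauss_bump t m x).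
  by rewrite normal_pdf01E mulrCA fE; ring.
have I := integrable_quartic m c0 c1 c2 c3 c4 t0; split.
  apply: eq_integrable (integrableZl_fin ((Num.sqrt (2 * pi))^-1 * C) I) => // x _.
  by congr EFin; rewrite E.
under eq_Rintegral do rewrite E.
rewrite RintegralZl// gauss_moments// (sqrtrM _ (ltW pi2)) (sqrtrV (ltW t0)).
have tn0 : t != 0 by rewrite gt_eqF.
have st0 : Num.sqrt t != 0 by rewrite gt_eqF// sqrtr_gt0.
by field; rewrite ?s2 ?st0 ?tn0.
Qed.

Lemma normal_expectation_quartic (c0 c1 c2 c3 c4 : R) :
  mu.-integrable setT (EFin \o (fun x => quartic c0 c1 c2 c3 c4 x * normal_pdf 0 1 x)) /\
  \int[mu]_x (quartic c0 c1 c2 c3 c4 x * normal_pdf 0 1 x) = c0 + c2 + 3 * c4.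
Proof.
have [|I ->] := @normal_expectation (quartic c0 c1 c2 c3 c4) 1 1 0 c0 c1 c2 c3 c4 ltr01.
  by move=> x; rewrite subr0 mul1r.
by split => //; rewrite sqrtr1 expr1n invr1; ring.
Qed.

Lemma measurable_quartic (c0 c1 c2 c3 c4 : R) :
  measurable_fun setT (quartic c0 c1 c2 c3 c4).
Proof.
apply: continuous_measurable_fun.
have := @continuous_quartic R c0 c1 c2 c3 c4 0.
by under eq_fun do rewrite subr0.
Qed.

Variable gamma : R.
Hypothesis gamma0 : 0 < gamma.

Lemma integral_stein_kernel_diag d :
  (std_gaussian d).-integrable setT
    (EFin \o (fun t : Rtuple R d => stein_kernel gamma (vec t) (vec t))) /\
  \int[std_gaussian d]_t stein_kernel gamma (vec t) (vec t) = (1 + 2 * gamma) * d%:R.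
Proof.
(* Each summand depends on a single coordinate; padding with the constant 1 turns it into a product
   over all of them. *)
pose f (i k : 'I_d) := if k == i then quartic (2 * gamma) 0 1 0 0 else quartic 1 0 0 0 0.
have mf i k : measurable_fun setT (f i k).
  by rewrite /f; case: ifP => _; exact: measurable_quartic.
have fP i k : mu.-integrable setT (EFin \o (fun x => f i k x * normal_pdf 0 1 x)).
  by rewrite /f; case: ifP => _; exact: (normal_expectation_quartic _ _ _ _ _).1.
have fI i := std_gaussian_prod (mf i) (fP i).
have E : (fun t : Rtuple R d => stein_kernel gamma (vec t) (vec t)) =
    (fun t => \sum_(i < d) \prod_(k < d) f i k (tnth t k)).
  apply/funext => t; rewrite /stein_kernel gauss_kernel_diag mul1r.
  apply: eq_bigr => i _; rewrite (bigD1 i)//= big1 ?mulr1.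
    by rewrite /f eqxx /quartic mxE; ring.
  by move=> k /negbTE ki; rewrite /f ki /quartic; ring.
rewrite E; have [I ->] := Rintegral_sum (index_enum 'I_d) (fun i => (fI i).1).
split=> //; transitivity (\sum_(i < d) (1 + 2 * gamma)).
  apply: eq_bigr => i _; rewrite (fI i).2 (bigD1 i)//= big1 ?mulr1.
    by rewrite /f eqxx (normal_expectation_quartic _ _ _ _ _).2; ring.
  move=> k /negbTE ki; rewrite /f ki (normal_expectation_quartic _ _ _ _ _).2; ring.
by rewrite sumr_const card_ord mulr_natr.
Qed.

(** Tilting the pair (a, b) by exp (- 2 gamma (a - b)^2) gives [b] the precision [tau] given [a];
    once [b] is integrated out, [a] has precision [sigma / tau]. *)
Let tau := 1 + 4 * gamma.
Let sigma := 1 + 8 * gamma.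
Let kappa := 2 * gamma + 4 * gamma ^+ 2.
Let tau_gt0 : 0 < tau. Proof. by rewrite addr_gt0// mulr_gt0. Qed.
Let sigma_gt0 : 0 < sigma. Proof. by rewrite addr_gt0// mulr_gt0. Qed.

(* [stein_kernel ^+ 2] is a sum of products over the coordinates of these factors. *)
Let F (e : nat) (a b : R) := expR (- 2 * gamma * (a - b) ^+ 2) *
  (a * b - kappa * (a - b) ^+ 2 + 2 * gamma) ^+ e.

(** [q0 a] and [q1 a] are the coefficients of degrees 0 and 1 of the polynomial factor of [F]
    expanded around the tilted mean 4 gamma a / tau of [b]; the coefficient of degree 2 is
    [- kappa]. Then [poly e a] is the conditional mean of its e-th power. *)
Let q0 (a : R) := (4 * gamma * tau - kappa) / tau ^+ 2 * a ^+ 2 + 2 * gamma.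
Let q1 (a : R) := (1 + 2 * kappa / tau) * a.

Let poly (e : nat) (a : R) : R := match e with
  | 0 => 1
  | 1 => q0 a - kappa / tau
  | _ => q0 a ^+ 2 + (q1 a ^+ 2 - 2 * q0 a * kappa) / tau + 3 * kappa ^+ 2 / tau ^+ 2
  end.

Let G (e : nat) (a : R) :=
  expR (- (2 * gamma / tau) * a ^+ 2) * (Num.sqrt tau)^-1 * poly e a.

Let F_expectation (e : nat) (a : R) : (e <= 2)%N ->
  mu.-integrable setT (EFin \o (fun b => F e a b * normal_pdf 0 1 b)) /\
  \int[mu]_b (F e a b * normal_pdf 0 1 b) = G e a.
Proof.
move=> e2.
pose m := 4 * gamma * a / tau.
pose C := expR (- (2 * gamma / tau) * a ^+ 2).
have t0 : tau != 0 by rewrite gt_eqF.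
have bump b : expR (- 2 * gamma * (a - b) ^+ 2) * gauss_bump 1 0 b =
    C * gauss_bump tau m b.
  rewrite /gauss_bump /C -!expRD; congr expR; rewrite /m.
  by move: t0; rewrite /tau => t0; field.
have qE b : a * b - kappa * (a - b) ^+ 2 + 2 * gamma =
    q0 a + q1 a * (b - m) - kappa * (b - m) ^+ 2.
  rewrite /q0 /q1 /m /kappa; move: t0; rewrite /tau => t0; field.
  exact: t0.
case: e e2 => [|[|[|//]]] _.
- have [|I ->] := @normal_expectation (F 0 a) C tau m 1 0 0 0 0 tau_gt0.
    by move=> b; rewrite /F expr0 mulr1 bump /quartic; ring.
  by split => //; rewrite /G /C /=; ring.
- have [|I ->] := @normal_expectation (F 1 a) C tau m (q0 a) (q1 a) (- kappa) 0 0 tau_gt0.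
    move=> b; rewrite /F expr1 mulrAC bump qE /quartic; ring.
  by split => //; rewrite /G /C /=; ring.
- have [|I ->] := @normal_expectation (F 2 a) C tau m (q0 a ^+ 2) (2 * q0 a * q1 a)
    (q1 a ^+ 2 - 2 * q0 a * kappa) (- 2 * q1 a * kappa) (kappa ^+ 2) tau_gt0.
    move=> b; rewrite /F mulrAC bump qE /quartic; ring.
  by split => //; rewrite /G /C /=; ring.
Qed.

(** Mean and variance of one coordinate factor under the tilted law. There a + b and a - b are
    independent with variances 2 and 2 / (1 + 8 gamma), and the factor equals ((a + b)^2 - (1 + 4
    gamma)^2 (a - b)^2) / 4 + 2 gamma; the two squares give the two terms of [var_coef]. *)
Definition mean_coef : R := 2 * gamma * (1 + 4 * gamma) / (1 + 8 * gamma).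
Definition var_coef : R := (1 + ((1 + 4 * gamma) ^+ 2 / (1 + 8 * gamma)) ^+ 2) / 2.

Let M (e : nat) : R := match e with
  | 0 => 1 | 1 => mean_coef | _ => mean_coef ^+ 2 + var_coef end.

Let G_expectation (e : nat) : (e <= 2)%N ->
  mu.-integrable setT (EFin \o (fun a => G e a * normal_pdf 0 1 a)) /\
  \int[mu]_a (G e a * normal_pdf 0 1 a) = (Num.sqrt sigma)^-1 * M e.
Proof.
move=> e2; pose t := sigma / tau.
have t0 : tau != 0 by rewrite gt_eqF.
have s0 : sigma != 0 by rewrite gt_eqF.
have tgt0 : 0 < t by rewrite divr_gt0.
have bump a : expR (- (2 * gamma / tau) * a ^+ 2) * gauss_bump 1 0 a =
    gauss_bump t 0 a.
  rewrite /gauss_bump -expRD; congr expR; rewrite /t subr0.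
  by move: t0; rewrite /tau /sigma => t0; field.
have sq : (Num.sqrt tau)^-1 * (Num.sqrt t)^-1 = (Num.sqrt sigma)^-1.
  rewrite -invfM -sqrtrM ?ltW// /t; congr (Num.sqrt _)^-1; field; exact: t0.
pose A := (4 * gamma * tau - kappa) / tau ^+ 2.
pose B := 1 + 2 * kappa / tau.
case: e e2 => [|[|[|//]]] _.
- have [|I ->] := @normal_expectation (G 0) (Num.sqrt tau)^-1 t 0 1 0 0 0 0 tgt0.
    by move=> a; rewrite /G subr0 /quartic -bump /=; ring.
  by split => //; rewrite sq /=; ring.
- have [|I ->] := @normal_expectation (G 1) (Num.sqrt tau)^-1 t 0
      (2 * gamma - kappa / tau) 0 A 0 0 tgt0.
    by move=> a; rewrite /G subr0 /quartic -bump /= /q0 -/A; ring.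
  split => //; rewrite sq /= /mean_coef /A /t /kappa; congr (_ * _).
  by move: t0 s0; rewrite /tau /sigma => t0 s0; field; rewrite t0 s0.
- have [|I ->] := @normal_expectation (G 2) (Num.sqrt tau)^-1 t 0
      (4 * gamma ^+ 2 - 4 * gamma * kappa / tau + 3 * kappa ^+ 2 / tau ^+ 2) 0
      (4 * gamma * A + B ^+ 2 / tau - 2 * A * kappa / tau) 0 (A ^+ 2) tgt0.
    by move=> a; rewrite /G subr0 /quartic -bump /= /q0 /q1 -/A -/B; ring.
  split => //; rewrite sq /= /mean_coef /var_coef /A /B /t /kappa; congr (_ * _).
  by move: t0 s0; rewrite /tau /sigma => t0 s0; field; rewrite t0 s0.
Qed.

Let prod_pred (d : nat) (i : 'I_d) (h : 'I_d -> R) : \prod_k h k ^+ (k == i) = h i.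
Proof.
by rewrite (bigD1 i)//= eqxx expr1 big1 ?mulr1// => k /negbTE ->; rewrite expr0.
Qed.

(** The exponent of coordinate [k] in the term of the expanded square indexed by the pair [p]; it is
    2 only when both indices equal [k]. *)
Let e_ (d : nat) (p : 'I_d * 'I_d) (k : 'I_d) : nat := (k == p.1) + (k == p.2).

Let e_le2 d p k : (@e_ d p k <= 2)%N.
Proof. by rewrite /e_; case: eqP; case: eqP. Qed.

Let stein_kernel_sqrE d (x y : 'rV[R]_d) : stein_kernel gamma x y ^+ 2 =
  \sum_(p : 'I_d * 'I_d) \prod_k F (e_ p k) (x 0 k) (y 0 k).
Proof.
pose q (i : 'I_d) := x 0 i * y 0 i - kappa * (x 0 i - y 0 i) ^+ 2 + 2 * gamma.
rewrite /stein_kernel -/kappa exprMn -[\sum_(i < d) _]/(\sum_i q i).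
have -> : gauss_kernel gamma x y ^+ 2 = \prod_(k < d) expR (- 2 * gamma * (x 0 k - y 0 k) ^+ 2).
  rewrite /gauss_kernel -expRM_natl -expR_sum; congr expR.
  rewrite /sqnorm !mulr_sumr; apply: eq_bigr => k _; rewrite !mxE; ring.
rewrite expr2 mulr_suml; under [X in _ * X]eq_bigr do rewrite mulr_sumr.
rewrite pair_bigA/= mulr_sumr; apply: eq_bigr => -[i j] _ /=.
rewrite /F big_split/=; congr (_ * _).
rewrite -(prod_pred i q) -(prod_pred j q) -big_split/=.
by apply: eq_bigr => k _; rewrite -exprD.
Qed.

Let measurable_F e a : measurable_fun setT (F e a).
Proof.
apply: measurable_funM.
  apply: measurableT_comp => //; apply: measurable_funM => //.
  by apply: measurable_funX; apply: measurable_funB.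
apply: measurable_funX; apply: measurable_funD => //; apply: measurable_funB.
  by apply: measurable_funM.
by apply: measurable_funM => //; apply: measurable_funX; apply: measurable_funB.
Qed.

Let measurable_G e : measurable_fun setT (G e).
Proof.
apply: measurable_funM.
  apply: measurable_funM => //; apply: measurableT_comp => //.
  by apply: measurable_funM => //; exact: measurable_funX.
pose A := (4 * gamma * tau - kappa) / tau ^+ 2.
pose B := 1 + 2 * kappa / tau.
case: e => [|[|e]]; first exact: measurable_cst.
  apply: eq_measurable_fun (measurable_quartic (2 * gamma - kappa / tau) 0 A 0 0).
  by move=> a _; rewrite /poly /q0 /quartic -/A; ring.
apply: eq_measurable_fun (measurable_quartic
    (4 * gamma ^+ 2 - 4 * gamma * kappa / tau + 3 * kappa ^+ 2 / tau ^+ 2) 0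
    (4 * gamma * A + B ^+ 2 / tau - 2 * A * kappa / tau) 0 (A ^+ 2)).
by move=> a _; rewrite /poly /q0 /q1 /quartic -/A -/B; ring.
Qed.

Lemma integral_stein_kernel_sqr d :
  \int[std_gaussian d]_s \int[std_gaussian d]_t
    (stein_kernel gamma (vec s) (vec t) ^+ 2) =
  (Num.sqrt (1 + 8 * gamma))^-1 ^+ d * (mean_coef ^+ 2 * d%:R ^+ 2 + var_coef * d%:R).
Proof.
pose idx := index_enum ('I_d * 'I_d)%type.
have inner (s : Rtuple R d) : \int[std_gaussian d]_t
    (stein_kernel gamma (vec s) (vec t) ^+ 2) =
    \sum_(p <- idx) \prod_k G (e_ p k) (tnth s k).
  have I p := @std_gaussian_prod R d (fun k => F (e_ p k) (tnth s k))
    (fun k => @measurable_F (e_ p k) (tnth s k))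
    (fun k => (F_expectation (tnth s k) (e_le2 p k)).1).
  transitivity (\int[std_gaussian d]_t
      (\sum_(p <- idx) \prod_k F (e_ p k) (tnth s k) (tnth t k))).
    apply: eq_Rintegral => t _; rewrite stein_kernel_sqrE; apply: eq_bigr => p _.
    by apply: eq_bigr => k _; rewrite !mxE.
  rewrite (Rintegral_sum idx (fun p => (I p).1)).2; apply: eq_bigr => p _.
  by rewrite (I p).2; apply: eq_bigr => k _; exact: (F_expectation _ (e_le2 p k)).2.
under eq_Rintegral do rewrite inner.
have J p := @std_gaussian_prod R d (fun k => G (e_ p k))
  (fun k => measurable_G (e_ p k)) (fun k => (G_expectation (e_le2 p k)).1).
rewrite (Rintegral_sum idx (fun p => (J p).1)).2.
(* Coordinates outside the pair contribute only the normalising factor; two distinct indices give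
   the squared mean, and a repeated one gives the second moment. *)
transitivity (\sum_(p : 'I_d * 'I_d) (Num.sqrt sigma)^-1 ^+ d *
    (mean_coef ^+ 2 + (p.1 == p.2)%:R * var_coef)).
  apply: eq_bigr => -[i j] _; rewrite (J _).2.
  rewrite (eq_bigr (fun k => (Num.sqrt sigma)^-1 * M (e_ (i, j) k))); last first.
    by move=> k _; exact: (G_expectation (e_le2 _ k)).2.
  rewrite big_split/= prodr_const card_ord; congr (_ * _).
  rewrite (bigD1 i)//= /e_ /= eqxx; have [->|ij] := eqVneq i j.
    rewrite big1 ?mulr1 ?mul1r// => k /negbTE kj; by rewrite kj.
  rewrite mul0r addr0 (bigD1 j)//=; last by rewrite eq_sym.
  rewrite eqxx eq_sym (negbTE ij)/= big1 ?mulr1 -?expr2//.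
  by move=> k /andP[/negbTE -> /negbTE ->].
rewrite -mulr_sumr big_split/= sumr_const card_prod card_ord; congr (_ * (_ + _)).
  by rewrite -[LHS]mulr_natr natrM expr2.
rewrite -(pair_bigA _ (fun i j : 'I_d => (i == j)%:R * var_coef))/=.
rewrite (eq_bigr (fun=> var_coef)); last first.
  move=> i _; rewrite (bigD1 i)//= eqxx mul1r big1 ?addr0// => j.
  by rewrite eq_sym => /negbTE ->; rewrite mul0r.
by rewrite sumr_const card_ord mulr_natr.
Qed.

End gaussian_traces.

(** * Asymptotic bounds *)

Section final_bounds.
Context {R : realType}.

(** The constant is kept because K^p <= K for K >= 1 and p <= 1. *)
Lemma within_factor_powR (K X Y p : R) : 1 <= K -> 0 <= Y -> 0 <= p <= 1 ->
  within_factor K X Y -> within_factor K (X `^ p) (Y `^ p).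
Proof.
move=> K1 Y0 /andP[p0 p1] [lb ub]; have K0 : 0 < K by exact: lt_le_trans K1.
have KV0 : 0 <= K^-1 by rewrite invr_ge0 ltW.
have X0 : 0 <= X by apply: le_trans lb; rewrite mulr_ge0.
have Kp : K `^ p <= K by rewrite -[leRHS](powRr1 (ltW K0)) ler_powR.
split.
- apply: (@le_trans _ _ ((K^-1 * Y) `^ p)); last first.
    by apply: ge0_ler_powR => //; rewrite nnegrE// mulr_ge0.
  rewrite powRM// ler_wpM2r ?powR_ge0//.
  by rewrite -[leLHS](powRr1 KV0) ger_powR// invr_gt0 K0 invf_le1.
- apply: (@le_trans _ _ ((K * Y) `^ p)).
    by apply: ge0_ler_powR => //; rewrite nnegrE// mulr_ge0// (ltW K0).
  by rewrite powRM ?(ltW K0)// ler_wpM2r ?powR_ge0.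
Qed.

Lemma within_factor_div (K X Y A B : R) : 1 <= K -> 0 < Y -> 0 <= B ->
  within_factor K X Y -> within_factor K A B -> within_factor (K ^+ 2) (A / X) (B / Y).
Proof.
move=> K1 Y0 B0 [lX uX] [lA uA]; have K0 : 0 < K by exact: lt_le_trans K1.
have X0 : 0 < X by apply: lt_le_trans lX; rewrite mulr_gt0// invr_gt0.
have A0 : 0 <= A by apply: le_trans lA; rewrite mulr_ge0// invr_ge0 ltW.
split.
- rewrite ler_pdivlMr// (_ : _ * X = K^-1 * B * (X / (K * Y))); last first.
    by field; rewrite !gt_eqF.
  apply: le_trans lA; rewrite ler_piMr ?mulr_ge0 ?invr_ge0 ?(ltW K0)//.
  by rewrite ler_pdivrMr ?mul1r ?mulr_gt0.
- rewrite ler_pdivrMr// (_ : _ * X = K * B * (X / (K^-1 * Y))); last first.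
    by field; rewrite !gt_eqF.
  apply: (le_trans uA); rewrite ler_peMr ?mulr_ge0 ?(ltW K0)//.
  by rewrite ler_pdivlMr ?mul1r ?mulr_gt0 ?invr_gt0.
Qed.

(** The quotient costs a factor K^2, which the first square root brings back to K and the second
    keeps at most K. One constant can thus serve all claims. *)
Lemma within_factor_gap (K X Y A B : R) : 1 <= K -> 0 < Y -> 0 <= B ->
  within_factor K X Y -> within_factor K A B ->
  within_factor K ((A / X) `^ (1 / 4)) ((B / Y) `^ (1 / 4)).
Proof.
move=> K1 Y0 B0 KXY KAB; have K0 : 0 < K by exact: lt_le_trans K1.
have BY0 : 0 <= B / Y by rewrite divr_ge0// ltW.
have half : within_factor K ((A / X) `^ (1 / 2)) ((B / Y) `^ (1 / 2)).
  have [l u] := within_factor_div K1 Y0 B0 KXY KAB.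
  have AX0 : 0 <= A / X.
    by apply: le_trans l; rewrite mulr_ge0// invr_ge0 sqr_ge0.
  have s x : 0 <= x -> x `^ (1 / 2) = Num.sqrt x by move=> x0; rewrite mul1r powR12_sqrt.
  rewrite !s//; split.
  - rewrite -[K](ger0_norm (ltW K0)) -sqrtr_sqr -sqrtrV ?sqr_ge0// -sqrtrM ?invr_ge0 ?sqr_ge0//.
    by rewrite ler_wsqrtr.
  - rewrite -[K](ger0_norm (ltW K0)) -sqrtr_sqr -sqrtrM ?sqr_ge0//.
    by rewrite ler_wsqrtr.
have -> : 1 / 4 = 1 / 2 * (1 / 2) :> R by field.
rewrite !(powRrM _ (1 / 2)); apply: within_factor_powR => //; first exact: powR_ge0.
by apply/andP; split; lra.
Qed.

Lemma within_factorM2r (K a b c : R) : 0 <= c ->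
  within_factor K a b -> within_factor K (a * c) (b * c).
Proof.
by move=> c0 [l u]; rewrite /within_factor !mulrA; split; exact: ler_wpM2r.
Qed.

Section traces.
Variables (d : nat) (gamma : R) (H : hspace ('rV[R]_d -> R^o)).
Variable E : set ('rV[R]_d -> 'rV[R]_d).
Hypothesis gamma0 : 0 < gamma.
Hypothesis Hk : is_rkhs (gauss_kernel gamma) H.
Hypothesis hE : orthonormal_basis (hpow H d) E.

Lemma trace_gauss_stein_cov :
  trace (hpow H d) E (gauss_stein_cov gamma H) = (1 + 2 * gamma) * d%:R.
Proof.
have [I V] := integral_stein_kernel_diag gamma d.
by rewrite (trace_stein_cov gamma0 Hk hE I) V.
Qed.

Lemma trace_gauss_stein_cov_sqr :
  trace (hpow H d) E (gauss_stein_cov gamma H \o gauss_stein_cov gamma H) =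
  (Num.sqrt (1 + 8 * gamma))^-1 ^+ d *
  (mean_coef gamma ^+ 2 * d%:R ^+ 2 + var_coef gamma * d%:R).
Proof.
have [I _] := integral_stein_kernel_diag gamma d.
by rewrite (trace_stein_cov_sqr gamma0 Hk hE I) (integral_stein_kernel_sqr gamma0).
Qed.

(** All claims reduce to the bound on tr C^2: tr C is exact, and its square differs from d^2 by the
    factor (1 + 2 gamma)^2 only. *)
Lemma within_factor_scales (K Y : R) : 1 <= K -> 0 < Y -> (1 + 2 * gamma) ^+ 2 <= K ->
  let T := gauss_stein_cov gamma H in
  within_factor K (trace (hpow H d) E (T \o T)) Y ->
  (forall n : nat, (0 < n)%N -> within_factor K (optimal_scale (hpow H d) E T n)
    (Y `^ (1 / 4) / Num.sqrt n%:R)) /\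
  within_factor K (scale_gap (hpow H d) E T) ((d%:R ^+ 2 / Y) `^ (1 / 4)).
Proof.
move=> K1 Y0 gK T TY; have K0 : 0 < K by exact: lt_le_trans K1.
split=> [n n0|].
  apply: within_factorM2r; first by rewrite invr_ge0 sqrtr_ge0.
  apply: within_factor_powR => //; first exact: ltW.
  by apply/andP; split; lra.
apply: within_factor_gap => //.
rewrite trace_gauss_stein_cov exprMn; split; last by rewrite ler_wpM2r ?sqr_ge0.
rewrite ler_wpM2r ?sqr_ge0//; apply: (@le_trans _ _ 1); first by rewrite invf_le1.
by rewrite expr_ge1//; [move: gamma0; lra|move: gamma0; lra].
Qed.

End traces.
End final_bounds.

Theorem corollary11 (R : realType) :
  [/\ (* plug-in scale *)
      forall (gamma : R) (d n : nat) (H : hspace ('rV[R]_d -> R^o))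
          (E : set ('rV[R]_d -> 'rV[R]_d)),
        0 < gamma -> (0 < d)%N -> (0 < n)%N ->
        is_rkhs (gauss_kernel gamma) H -> orthonormal_basis (hpow H d) E ->
        plugin_scale (hpow H d) E (gauss_stein_cov gamma H) n =
          Num.sqrt ((1 + 2 * gamma) * d%:R / n%:R),
      (* fixed bandwidth *)
      forall gamma : R, 0 < gamma ->
        exists2 C : R, 0 < C &
          forall (d : nat) (H : hspace ('rV[R]_d -> R^o))
              (E : set ('rV[R]_d -> 'rV[R]_d)),
            (0 < d)%N ->
            is_rkhs (gauss_kernel gamma) H ->
            orthonormal_basis (hpow H d) E ->
            let T := gauss_stein_cov gamma H in
            [/\ within_factor C
                  (trace (hpow H d) E (T \o T))
                  (d%:R ^+ 2 * (1 + 8 * gamma) `^ (- (d%:R / 2))),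
                forall n : nat, (0 < n)%N ->
                  within_factor C
                    (optimal_scale (hpow H d) E T n)
                    (d%:R `^ (1 / 2) * (1 + 8 * gamma) `^ (- (d%:R / 8))
                       / Num.sqrt n%:R)
              & within_factor C
                  (scale_gap (hpow H d) E T)
                  ((1 + 8 * gamma) `^ (d%:R / 8))]
    & (* scaled bandwidth *)
      forall alpha : R, 0 < alpha ->
        exists2 C : R, 0 < C &
          forall (d : nat) (H : hspace ('rV[R]_d -> R^o))
              (E : set ('rV[R]_d -> 'rV[R]_d)),
            (0 < d)%N ->
            let gamma := alpha / d%:R in
            is_rkhs (gauss_kernel gamma) H ->
            orthonormal_basis (hpow H d) E ->
            let T := gauss_stein_cov gamma H in
            [/\ within_factor C (trace (hpow H d) E (T \o T)) d%:R,
                forall n : nat, (0 < n)%N ->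
                  within_factor C
                    (optimal_scale (hpow H d) E T n)
                    (d%:R `^ (1 / 4) / Num.sqrt n%:R)
              & within_factor C
                  (scale_gap (hpow H d) E T)
                  (d%:R `^ (1 / 4))]].
Proof.
split=> [gamma d n H E g0 d0 n0 Hk hE|gamma g0|alpha a0].
- by rewrite /plugin_scale trace_gauss_stein_cov.
- have s0 : 0 < 1 + 8 * gamma by lra.
  pose m := mean_coef gamma; pose v := var_coef gamma.
  have m0 : 0 < m by rewrite divr_gt0// !mulr_gt0//; lra.
  have v0 : 0 <= v by rewrite divr_ge0// addr_ge0// sqr_ge0.
  have m2 : 0 < m ^+ 2 by exact: exprn_gt0.
  have mV : 0 < (m ^+ 2)^-1 by rewrite invr_gt0.
  have g2 : 0 <= (1 + 2 * gamma) ^+ 2 by exact: sqr_ge0.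
  (* The summands serve in turn K >= 1, the lower bound m^2 d^2, the upper bound (m^2 + v) d^2
     obtained from d <= d^2, and the square of tr C. *)
  pose K := 1 + (m ^+ 2)^-1 + (m ^+ 2 + v) + (1 + 2 * gamma) ^+ 2.
  have K1 : 1 <= K by rewrite /K; lra.
  have K0 : 0 < K by exact: lt_le_trans K1.
  exists K => // d H E d0 Hk hE T.
  have dge1 : 1 <= d%:R :> R by rewrite ler1n.
  have dgt0 : 0 < d%:R :> R by rewrite ltr0n.
  pose r := (Num.sqrt (1 + 8 * gamma))^-1 ^+ d.
  have r0 : 0 < r by rewrite exprn_gt0// invr_gt0 sqrtr_gt0.
  have rE : (1 + 8 * gamma) `^ (- (d%:R / 2)) = r.
    rewrite /r -powR12_sqrt ?ltW// -powRN -powR_mulrn ?powR_ge0// -powRrM.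
    by congr (_ `^ _); field.
  pose Y := d%:R ^+ 2 * (1 + 8 * gamma) `^ (- (d%:R / 2)).
  have Y0 : 0 < Y by rewrite mulr_gt0// ?exprn_gt0// powR_gt0.
  have TY : within_factor K (trace (hpow H d) E (T \o T)) Y.
    rewrite trace_gauss_stein_cov_sqr// -/r /Y rE -/m -/v.
    have KmV : K^-1 <= m ^+ 2.
      by rewrite -[leRHS]invrK lef_pV2 ?posrE// /K; lra.
    have Kmv : m ^+ 2 + v <= K by rewrite /K; lra.
    have dd : d%:R <= d%:R ^+ 2 :> R by rewrite expr2 ler_peMr// ltW.
    split; rewrite mulrA [leRHS]mulrC.
      rewrite ler_wpM2r ?(ltW r0)//; apply: (@le_trans _ _ (m ^+ 2 * d%:R ^+ 2)).
        by rewrite ler_wpM2r// sqr_ge0.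
      by rewrite lerDl mulr_ge0// ltW.
    rewrite ler_wpM2l ?(ltW r0)//.
    apply: (@le_trans _ _ ((m ^+ 2 + v) * d%:R ^+ 2)).
      by rewrite mulrDl lerD2l ler_wpM2l.
    by rewrite ler_wpM2r// sqr_ge0.
  have gK : (1 + 2 * gamma) ^+ 2 <= K by rewrite /K; lra.
  have [opt gap] := within_factor_scales g0 Hk hE K1 Y0 gK TY.
  split=> //.
  + move=> n n0; have := opt n n0; congr (within_factor _ _ (_ / _)).
    rewrite /Y powRM ?sqr_ge0 ?powR_ge0// -powRrM -powR_mulrn ?ltW// -powRrM.
    by congr (_ `^ _ * _ `^ _); field.
  + move: gap; congr (within_factor _ _ _).
    rewrite /Y invfM mulrA divff ?mul1r ?gt_eqF ?exprn_gt0//.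
    by rewrite -powRN opprK -powRrM; congr (_ `^ _); field.
- pose c := 4 * alpha ^+ 2 + (1 + (1 + 4 * alpha) ^+ 4) / 2.
  pose K := 1 + 2 * expR (4 * alpha) + c + (1 + 2 * alpha) ^+ 2.
  have e0 := expR_gt0 (4 * alpha).
  have a2 := sqr_ge0 alpha.
  have a4 : 0 <= (1 + 4 * alpha) ^+ 4 by rewrite exprn_ge0//; lra.
  have g2 : 0 <= (1 + 2 * alpha) ^+ 2 by exact: sqr_ge0.
  have c0 : 0 <= c by rewrite /c; lra.
  have K1 : 1 <= K by rewrite /K; lra.
  have K0 : 0 < K by exact: lt_le_trans K1.
  exists K => // d H E d0 gamma Hk hE T.
  have dge1 : 1 <= d%:R :> R by rewrite ler1n.
  have dgt0 : 0 < d%:R :> R by rewrite ltr0n.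
  have g0 : 0 < gamma by exact: divr_gt0.
  have ga : gamma <= alpha by rewrite /gamma ler_pdivrMr// ler_peMr// ltW.
  have gd : gamma * d%:R = alpha by rewrite /gamma divfK// gt_eqF.
  have s0 : 0 < 1 + 8 * gamma by lra.
  pose r := (Num.sqrt (1 + 8 * gamma))^-1 ^+ d.
  have s1 : 1 <= Num.sqrt (1 + 8 * gamma).
    by rewrite -[leLHS]sqrtr1 ler_wsqrtr//; lra.
  have r1 : r <= 1.
    by rewrite exprn_ile1 ?invr_ge0 ?sqrtr_ge0// invf_le1// (lt_le_trans _ s1).
  (* From 1 + 8 gamma <= exp (8 gamma): the d-th power of its square root is at most exp (4 gamma d)
     = exp (4 alpha). *)
  have rlb : (expR (4 * alpha))^-1 <= r.
    rewrite /r exprVn lef_pV2 ?posrE ?exprn_gt0 ?sqrtr_gt0//.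
    rewrite -gd mulrA expRM_natr lerXn2r ?nnegrE ?sqrtr_ge0 ?expR_ge0//.
    rewrite -[leRHS]ger0_norm ?expR_ge0// -sqrtr_sqr ler_wsqrtr//.
    rewrite -expRM_natr.
    have -> : 4 * gamma * 2 = 8 * gamma by ring.
    exact: expR_ge1Dx.
  have r0 : 0 < r by apply: lt_le_trans rlb; rewrite invr_gt0.
  have TY : within_factor K (trace (hpow H d) E (T \o T)) d%:R.
    rewrite trace_gauss_stein_cov_sqr// -/r.
    have -> : mean_coef gamma ^+ 2 * d%:R ^+ 2 + var_coef gamma * d%:R =
       (2 * alpha * ((1 + 4 * gamma) / (1 + 8 * gamma))) ^+ 2 + var_coef gamma * d%:R.
      by rewrite -gd /mean_coef; field; rewrite gt_eqF.
    have q0 : 0 <= (1 + 4 * gamma) / (1 + 8 * gamma) by rewrite divr_ge0//; lra.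
    have q1 : (1 + 4 * gamma) / (1 + 8 * gamma) <= 1 by rewrite ler_pdivrMr//; lra.
    have vlb : 1 / 2 <= var_coef gamma.
      by rewrite /var_coef; have := sqr_ge0 ((1 + 4 * gamma) ^+ 2 / (1 + 8 * gamma)); lra.
    have vub : var_coef gamma <= (1 + (1 + 4 * alpha) ^+ 4) / 2.
      rewrite /var_coef ler_pM2r ?invr_gt0// lerD2l.
      apply: (@le_trans _ _ (((1 + 4 * gamma) ^+ 2) ^+ 2)).
        rewrite lerXn2r ?nnegrE ?divr_ge0 ?sqr_ge0 ?(ltW s0)//.
        by rewrite ler_pdivrMr// ler_peMr ?sqr_ge0//; lra.
      by rewrite -exprM lerXn2r ?nnegrE//; lra.
    set q := (_ / _) in q0 q1 *; set w := var_coef gamma in vlb vub *.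
    have q2 : 0 <= (2 * alpha * q) ^+ 2 <= 4 * alpha ^+ 2.
      rewrite sqr_ge0/= (_ : (2 * alpha * q) ^+ 2 = 4 * alpha ^+ 2 * q ^+ 2); last by ring.
      by apply: ler_piMr; [rewrite mulr_ge0|exact: exprn_ile1].
    have /andP[q20 q2u] := q2.
    have vd : w * d%:R <= (1 + (1 + 4 * alpha) ^+ 4) / 2 * d%:R by rewrite ler_wpM2r// ltW.
    have vd' : 1 / 2 * d%:R <= w * d%:R by rewrite ler_wpM2r// ltW.
    split.
      apply: (@le_trans _ _ ((expR (4 * alpha))^-1 * (1 / 2 * d%:R))).
        rewrite mulrA ler_wpM2r ?(ltW dgt0)// mul1r -invfM lef_pV2 ?posrE ?mulr_gt0// /K; lra.
      apply: ler_pM; [by rewrite invr_ge0 ltW|by rewrite mulr_ge0// (ltW dgt0)|exact: rlb|].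
      by apply: (le_trans vd'); rewrite lerDr.
    apply: (@le_trans _ _ (c * d%:R)); last by rewrite ler_wpM2r ?(ltW dgt0)// /K; lra.
    rewrite -[leRHS]mul1r; apply: ler_pM => //; first exact: (ltW r0).
      by rewrite addr_ge0// (le_trans _ vd')// mulr_ge0// (ltW dgt0).
    rewrite /c [leRHS]mulrDl; apply: lerD => //; apply: (le_trans q2u).
    by rewrite ler_peMr// mulr_ge0.
  have gK : (1 + 2 * gamma) ^+ 2 <= K.
    apply: (@le_trans _ _ ((1 + 2 * alpha) ^+ 2)); last by rewrite /K; lra.
    by rewrite lerXn2r ?nnegrE//; lra.
  have [opt gap] := within_factor_scales g0 Hk hE K1 dgt0 gK TY.
  split=> //.
  by move: gap; rewrite expr2 mulfK ?gt_eqF.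
Qed.
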